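(* Let $h:\mathbb{R}\to\mathbb{R}$ satisfy Assumptions 1 and 2 (stated in the context), with minimiser $x^\star$, functions $m$, $\alpha$ and constant $A$. Let $r,\delta,d$ be arbitrary positive numbers such that $r-d-2\delta>0$ and $\underline{\delta}^\star(\delta)\ge A+\bar b$ for some $\bar b>0$. Let $r_0:=\chi(r-d-2\delta)$. Then there exist $\bar t=\bar t(r_0,d)$ and $\gamma^\star=\gamma^\star(L_r,\delta,d)>0$ such that for any $\gamma\in(0,\gamma^\star)$ and any $(x_0,\bar y_0)\in\mathbb{R}^2$ fulfilling $|x_0-x^\star|\le r_0$ and $|\bar y_0-a_{0,\delta}(x_0)/2|\le\gamma^\star$, the trajectories of $$\begin{aligned}\dot x&=-\gamma\bigl(h(x+\delta u(t))-\bar y\bigr)u(t),& x(0)&=x_0,\\ \dot{\bar y}&=\gamma\bigl(h(x+\delta u(t))-\bar y\bigr),&\bar y(0)&=\bar y_0,\end{aligned}\qquad u(t)=\sin(2\pi t),$$ are bounded and $$\|(x(t),\bar y(t))\|_{\operatorname{graph}\tau|_{\mathcal{A}_\delta}}\le d\qquad\text{for all } t\ge\frac{\bar t}{\gamma}.$$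
   Context: Assumption 1: the function $h$ is smooth and there exists $x^\star\in\mathbb{R}$ such that $h(x)-h(x^\star)>0$ for all $x\in\mathbb{R}$ with $x\neq x^\star$. Assumption 2: there exist a locally Lipschitz and strictly quasi-convex function $m:\mathbb{R}\to\mathbb{R}$, a class-$\mathcal{K}_\infty$ function $\alpha$, and a constant $A\ge 0$ such that (1) $m(x)-A\le h(x)\le m(x)+A$ for all $x\in\mathbb{R}$; (2) for all $x_1,x_2\in\mathbb{R}$ with $(x_1-x^\star)(x_2-x^\star)\ge 0$, one has $|m(x_2)-m(x_1)|\ge\alpha(|x_2-x_1|)$. (Strictly quasi-convex: $m(x)<m(y)$ implies $m(\theta x+(1-\theta)y)<m(y)$ for all $\theta\in(0,1)$.) The function $\underline{\delta}^\star$ is $\underline{\delta}^\star(s):=2\int_0^{1/2}\alpha\bigl(s\sin(2\pi t)\bigr)\,dt$. Fourier coefficients: $a_{0,\delta}(x):=2\int_0^1 h(x+\delta\sin(2\pi t))\,dt$ and $b_{1,\delta}(x):=2\int_0^1 h(x+\delta\sin(2\pi t))\sin(2\pi t)\,dt$. The average system is $$\dot x_a=-\gamma\frac{b_{1,\delta}(x_a)}{2},\qquad \dot{\bar y}_a=-\gamma\bar y_a+\gamma\frac{a_{0,\delta}(x_a)}{2}.$$ The compact set $\mathcal{A}_\delta\subseteq[x^\star-\delta,x^\star+\delta]$ and the continuous function $\tau:\mathbb{R}\to\mathbb{R}$ are such that $\mathcal{A}_\delta$ is globally asymptotically and locally exponentially stable for the $x_a$-subsystem and $\operatorname{graph}\tau|_{\mathcal{A}_\delta}:=\{(x_a,y_a)\in\mathcal{A}_\delta\times\mathbb{R}: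 y_a=\tau(x_a)\}$ is globally asymptotically and locally exponentially stable for the full average system (such $\mathcal{A}_\delta$ and $\tau$ exist under the stated conditions on $\delta$ and $A$). $|\cdot|_S$ and $\|\cdot\|_S$ denote the distance to the set $S$. The function $\beta$ is a class-$\mathcal{KL}$ function such that all solutions of the $x_a$-subsystem satisfy $|x_a(t)|_{\mathcal{A}_\delta}\le\beta(|x_a(0)|_{\mathcal{A}_\delta},\gamma t)$ for all $t\ge0$, and $\chi(s):=\beta^{-1}(s,0)$ is the class-$\mathcal{K}_\infty$ function that is the inverse of $s\mapsto\beta(s,0)$ (which is taken of class $\mathcal{K}_\infty$). For $r>0$, $L_r>0$ denotes a Lipschitz constant of $h$ on $[x^\star-r,x^\star+r]$. The arguments displayed in $\bar t(\cdot)$ and $\gamma^\star(\cdot)$ list the quantities on which these numbers depend, besides the average system and its stability estimates; in particular $\gamma^\star$ does not depend on an upper bound $M_r$ of $|h|$ on $[x^\star-r,x^\star+r]$. *)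

(* Defs.v *)
From Stdlib Require Import Reals.
From Coquelicot Require Import Coquelicot.
Open Scope R_scope.

(* Comparison functions live on [0, +oo); a function R -> R is constrained
   only there, and its values on negative reals are irrelevant. *)
Definition class_K (f : R -> R) : Prop :=
  continuous_on (fun s => 0 <= s) f /\ f 0 = 0 /\
  (forall s1 s2, 0 <= s1 -> s1 < s2 -> f s1 < f s2).

Definition class_Kinf (f : R -> R) : Prop :=
  class_K f /\ is_lim f p_infty p_infty.

Definition class_KL (beta : R -> R -> R) : Prop :=
  (forall t, 0 <= t -> class_K (fun s => beta s t)) /\
  (forall s, 0 <= s ->
     (forall t1 t2, 0 <= t1 -> t1 <= t2 -> beta s t2 <= beta s t1) /\
     is_lim (beta s) p_infty 0).

Definition is_Kinf_inverse (chi f : R -> R) : Prop :=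
  forall s, 0 <= s -> 0 <= chi s /\ f (chi s) = s /\ chi (f s) = s.

Definition locally_lipschitz (f : R -> R) : Prop :=
  forall x, exists eps L, 0 < eps /\
    forall y z, Rabs (y - x) < eps -> Rabs (z - x) < eps ->
      Rabs (f y - f z) <= L * Rabs (y - z).

Definition lipschitz_on (D : R -> Prop) (L : R) (f : R -> R) : Prop :=
  forall y z, D y -> D z -> Rabs (f y - f z) <= L * Rabs (y - z).

Definition strictly_quasi_convex (f : R -> R) : Prop :=
  forall x y, f x < f y ->
    forall theta, 0 < theta < 1 -> f (theta * x + (1 - theta) * y) < f y.

Definition smooth (f : R -> R) : Prop := forall n x, ex_derive_n f n x.

Definition assumption1 (h : R -> R) (xstar : R) : Prop :=
  smooth h /\ forall x, x <> xstar -> h x - h xstar > 0.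

Definition assumption2 (h : R -> R) (xstar : R) (m alpha : R -> R) (A : R)
  : Prop :=
  locally_lipschitz m /\ strictly_quasi_convex m /\ class_Kinf alpha /\
  0 <= A /\
  (forall x, m x - A <= h x <= m x + A) /\
  (forall x1 x2, (x1 - xstar) * (x2 - xstar) >= 0 ->
     Rabs (m x2 - m x1) >= alpha (Rabs (x2 - x1))).

Definition dither (t : R) : R := sin (2 * PI * t).

Definition delta_star (alpha : R -> R) (s : R) : R :=
  2 * RInt (fun t => alpha (s * dither t)) 0 (1 / 2).

Definition fourier_a0 (h : R -> R) (delta x : R) : R :=
  2 * RInt (fun t => h (x + delta * dither t)) 0 1.

Definition fourier_b1 (h : R -> R) (delta x : R) : R :=
  2 * RInt (fun t => h (x + delta * dither t) * dither t) 0 1.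

(* Solution of z' = F(t, z) on [0, T), with T possibly +oo.  Continuity from
   the right at 0 together with the equation on (0, T) amounts to the equation
   on [0, T) with a one-sided derivative at 0; values of z outside [0, T) are
   irrelevant. *)
Definition is_solution {V : NormedModule R_AbsRing}
    (F : R -> V -> V) (T : Rbar) (z : R -> V) : Prop :=
  Rbar_lt 0 T /\
  filterlim z (at_right 0) (locally (z 0)) /\
  (forall t : R, 0 < t -> Rbar_lt t T -> is_derive z t (F t (z t))).

(* The norm of the normed module R * R is the Euclidean one.  For an empty S
   the infimum is +oo and the value is 0, so S must be assumed nonempty. *)
Definition dist_to {V : NormedModule R_AbsRing} (S : V -> Prop) (z : V) : R :=
  real (Glb_Rbar (fun s : R => exists q : V, S q /\ s = norm (minus z q))).

Definition globally_asymptotically_stable {V : NormedModule R_AbsRing}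
    (F : R -> V -> V) (S : V -> Prop) : Prop :=
  exists beta, class_KL beta /\
    forall (T : Rbar) (z : R -> V), is_solution F T z ->
      forall t : R, 0 <= t -> Rbar_lt t T ->
        dist_to S (z t) <= beta (dist_to S (z 0)) t.

Definition locally_exponentially_stable {V : NormedModule R_AbsRing}
    (F : R -> V -> V) (S : V -> Prop) : Prop :=
  exists rho M lambda, 0 < rho /\ 0 < M /\ 0 < lambda /\
    forall (T : Rbar) (z : R -> V), is_solution F T z ->
      dist_to S (z 0) <= rho ->
      forall t : R, 0 <= t -> Rbar_lt t T ->
        dist_to S (z t) <= M * exp (- lambda * t) * dist_to S (z 0).

(* The average vector fields take the Fourier coefficients as arguments, so
   that the average system can be fixed before the function h generating it. *)
Definition avg_x_field (b1 : R -> R) (gamma : R) (t : R) (xa : R) : R :=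
  - gamma * (b1 xa / 2).

Definition avg_field (a0 b1 : R -> R) (gamma : R) (t : R) (p : R * R) : R * R :=
  (- gamma * (b1 (fst p) / 2),
   - gamma * snd p + gamma * (a0 (fst p) / 2)).

Definition es_field (h : R -> R) (delta gamma : R) (t : R) (p : R * R)
  : R * R :=
  (- gamma * (h (fst p + delta * dither t) - snd p) * dither t,
   gamma * (h (fst p + delta * dither t) - snd p)).

Definition graph_on (tau : R -> R) (S : R -> Prop) (p : R * R) : Prop :=
  S (fst p) /\ snd p = tau (fst p).

(* Main.v *)
Require Import Defs.
From Stdlib Require Import Reals Lra Lia Classical IndefiniteDescription.
From Coquelicot Require Import Coquelicot.
Open Scope R_scope.

(* Write v = b1 / 2, a = a0 / 2 and [p, q] for the convex hull of the attractor.
   Over one period the trajectory makes an Euler step of size gamma for the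
   average field, up to an error O(gamma^2) whose constant involves only L and
   delta, because h enters through its variation and through y - a(x).
   As the attractor contains all zeros of v, and the assumptions on h keep v away
   from 0 far out, v is bounded away from 0 outside every neighbourhood of [p, q].
   Hence x descends to such a neighbourhood without ever leaving
   [xstar - r + delta, xstar + r - delta], and then y - a(x) contracts to a bound
   that depends on the average system only. From there the trajectory is compared,
   on a window of fixed slow time ending at t, with the average solution started at
   its beginning; that solution is close to the graph at the end of the window by
   uniform attractivity. Of the slow times involved, only the window length enters
   gstar, so gstar depends neither on r nor on r0; and L does not enter tbar. *)

(** * Existence of solutions *)

(** The order of the quantifiers shapes the proof: [tbar] and [gstar] are chosen before h, from the
    average system alone. What they need of it, local Lipschitz constants of a and v and lower
    bounds on |v| away from [p, q], is read off from one arbitrary admissible function with the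
    given Fourier coefficients; without such a function the claim is vacuous. The function h that
    comes later enters the constants through L only. Each trajectory is therefore estimated twice:
    with L and delta, which keeps the error of a period under control from the start, and with the
    constants of a and v on intervals around [p, q], which measure how long descent and decay take.
    Confinement comes from the sign of v. The role of beta is to give r0 <= r - d - 2 delta: an
    average solution starts at distance r0 from the attractor, so r0 <= beta(r0, 0). The remaining
    room absorbs the dither, the width of the attractor around xstar and the margin eta. Since h is
    Lipschitz only locally, existence is proved for h truncated outside [xstar - r, xstar + r];
    confinement shows that the truncation is never felt. *)

Lemma continuous_eps (f : R -> R) (x : R) :
  continuous f x <->
  (forall eps, 0 < eps -> locally x (fun y => Rabs (f y - f x) < eps)).
Proof.
  split.
  - intros H eps He.
    exact (proj1 (filterlim_locally f (f x)) H (mkposreal eps He)).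
  - intros H; apply filterlim_locally; intros [eps He]; exact (H eps He).
Qed.

Lemma continuous_lipschitz_field (f : R -> R -> R -> R) (K : R) (x y : R -> R) (s : R) :
  (forall s x y x' y',
     Rabs (f s x y - f s x' y') <= K * (Rabs (x - x') + Rabs (y - y'))) ->
  (forall x y s, continuous (fun s => f s x y) s) ->
  continuous x s -> continuous y s ->
  continuous (fun s => f s (x s) (y s)) s.
Proof.
  intros HL Hc Hx Hy.
  apply continuous_eps; intros eps He.
  set (k := Rabs K + 1).
  assert (Hk : 0 < k) by (unfold k; generalize (Rabs_pos K); lra).
  assert (HKk : K <= k) by (unfold k; generalize (Rle_abs K); lra).
  assert (He' : 0 < eps / (4 * k)) by (apply Rdiv_lt_0_compat; lra).
  generalize (proj1 (continuous_eps _ _) Hx _ He'),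
    (proj1 (continuous_eps _ _) Hy _ He'),
    (proj1 (continuous_eps _ _) (Hc (x s) (y s) s) (eps / 2) ltac:(lra)).
  intros H1 H2 H3.
  generalize (filter_and _ _ H1 (filter_and _ _ H2 H3)).
  apply filter_imp; intros u (U1 & U2 & U3).
  replace (f u (x u) (y u) - f s (x s) (y s)) with
    ((f u (x u) (y u) - f u (x s) (y s)) + (f u (x s) (y s) - f s (x s) (y s))) by ring.
  eapply Rle_lt_trans; [apply Rabs_triang|].
  generalize (HL u (x u) (y u) (x s) (y s)); intros H4.
  assert (Rabs (f u (x u) (y u) - f u (x s) (y s)) <= eps / 2); [|lra].
  eapply Rle_trans; [exact H4|].
  apply Rle_trans with (k * (eps / (4 * k) + eps / (4 * k))).
  - apply Rmult_le_compat; try lra; [|].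
    2: generalize (Rabs_pos (x u - x s)), (Rabs_pos (y u - y s)); lra.
    destruct (Rle_or_lt 0 K); [assumption|].
    (* A negative [K] is impossible: the states (0, 0) and (1, 0) at time 0 already force 0 <= K. *)
    exfalso. generalize (HL 0 0 0 1 0).
    generalize (Rabs_pos (f 0 0 0 - f 0 1 0)).
    replace (0 - 1) with (-(1)) by ring. rewrite Rabs_Ropp, Rabs_R1.
    replace (0 - 0) with 0 by ring. rewrite Rabs_R0. lra.
  - apply Req_le. field. lra.
Qed.

Lemma continuous_Rabs_id (s : R) : continuous Rabs s.
Proof. apply continuity_pt_filterlim, Rcontinuity_abs. Qed.

Lemma is_RInt_exp_scal (C k t : R) :
  k <> 0 -> is_RInt (fun s => C * exp (k * s)) 0 t (C / k * (exp (k * t) - 1)).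
Proof.
  intros Hk.
  replace (C / k * (exp (k * t) - 1)) with
    (minus (C / k * exp (k * t)) (C / k * exp (k * 0)))
    by (unfold minus, plus, opp; simpl; rewrite Rmult_0_r, exp_0; field; exact Hk).
  apply (is_RInt_derive (fun s => C / k * exp (k * s))).
  - intros x _. auto_derive; [trivial|]. field. exact Hk.
  - intros x _. apply (ex_derive_continuous (fun s => C * exp (k * s))).
    auto_derive. trivial.
Qed.

(** * Global Picard iteration for planar systems *)

Section Picard.

Variables (F : bool -> R -> R -> R -> R) (K B : R) (z0 : bool -> R).
Hypothesis HK : 0 < K.
Hypothesis HLip : forall i s x y x' y',
  Rabs (F i s x y - F i s x' y') <= K * (Rabs (x - x') + Rabs (y - y')).
Hypothesis Hcont : forall i x y s, continuous (fun s => F i s x y) s.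
Hypothesis HB : forall i s, Rabs (F i s (z0 true) (z0 false)) <= B.

(* The time argument is reflected to [Rabs s], so that the iterates solve the
   equation on [0, +oo) and yet are differentiable on both sides of 0. *)
Definition picard_map (z : bool -> R -> R) (i : bool) (t : R) : R :=
  z0 i + RInt (fun s => F i s (z true (Rabs s)) (z false (Rabs s))) 0 t.

Fixpoint picard_iter (n : nat) : bool -> R -> R :=
  match n with
  | O => fun i _ => z0 i
  | S n => picard_map (picard_iter n)
  end.

Lemma picard_integrand_continuous (z : bool -> R -> R) (i : bool) (s : R) :
  (forall j s, continuous (fun s => z j (Rabs s)) s) ->
  continuous (fun s => F i s (z true (Rabs s)) (z false (Rabs s))) s.
Proof.
  intros Hz.
  apply (continuous_lipschitz_field (F i) K (fun s => z true (Rabs s))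
    (fun s => z false (Rabs s))); auto.
Qed.

Lemma picard_map_derive (z : bool -> R -> R) (i : bool) (t : R) :
  (forall j s, continuous (fun s => z j (Rabs s)) s) ->
  is_derive (picard_map z i) t (F i t (z true (Rabs t)) (z false (Rabs t))).
Proof.
  intros Hz. unfold picard_map.
  evar_last.
  - apply @is_derive_plus; [apply @is_derive_const|].
    apply (is_derive_RInt (fun s => F i s (z true (Rabs s)) (z false (Rabs s))) _ 0).
    + apply filter_forall; intros u. apply @RInt_correct, @ex_RInt_continuous.
      intros; apply picard_integrand_continuous; auto.
    + apply picard_integrand_continuous; auto.
  - apply plus_zero_l.
Qed.

Lemma continuous_comp_Rabs (f : R -> R) :
  (forall s, continuous f s) -> forall s, continuous (fun s => f (Rabs s)) s.
Proof.
  intros Hf s. apply (continuous_comp Rabs f); [apply continuous_Rabs_id | apply Hf].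
Qed.

Lemma picard_iter_continuous n i s : continuous (picard_iter n i) s.
Proof.
  revert i s; induction n as [|n IH]; intros i s.
  - apply continuous_const.
  - apply @ex_derive_continuous. eexists. apply picard_map_derive.
    intros j. apply continuous_comp_Rabs. auto.
Qed.

(** In the norm weighted by exp(-4 K t) the map contracts by 1/2: the two components together give
    the factor 2 K, and integrating the weight divides by 4 K. The weight yields convergence on all
    of [0, oo) at once, without gluing of short intervals. *)
Lemma picard_map_contract (z w : bool -> R -> R) (C : R) (i : bool) (t : R) :
  (forall j s, continuous (fun s => z j (Rabs s)) s) ->
  (forall j s, continuous (fun s => w j (Rabs s)) s) ->
  (forall j s, 0 <= s -> Rabs (z j s - w j s) <= C * exp (4 * K * s)) ->
  0 <= t ->
  Rabs (picard_map z i t - picard_map w i t) <= C / 2 * exp (4 * K * t).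
Proof.
  intros Hz Hw Hzw Ht.
  assert (HC : 0 <= C).
  { generalize (Hzw true 0 (Rle_refl _)), (Rabs_pos (z true 0 - w true 0)).
    rewrite Rmult_0_r, exp_0. lra. }
  unfold picard_map.
  replace (_ + _ - _) with
   (minus (RInt (fun s => F i s (z true (Rabs s)) (z false (Rabs s))) 0 t)
          (RInt (fun s => F i s (w true (Rabs s)) (w false (Rabs s))) 0 t))
   by (unfold minus, plus, opp; simpl; ring).
  assert (E1 : ex_RInt (fun s => F i s (z true (Rabs s)) (z false (Rabs s))) 0 t)
    by (apply @ex_RInt_continuous; intros; apply picard_integrand_continuous; auto).
  assert (E2 : ex_RInt (fun s => F i s (w true (Rabs s)) (w false (Rabs s))) 0 t)
    by (apply @ex_RInt_continuous; intros; apply picard_integrand_continuous; auto).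
  rewrite <- RInt_minus; auto.
  apply Rle_trans with (2 * K * C / (4 * K) * (exp (4 * K * t) - 1)).
  - refine (norm_RInt_le (V := R_NormedModule)
      (fun s => minus (F i s (z true (Rabs s)) (z false (Rabs s)))
                      (F i s (w true (Rabs s)) (w false (Rabs s)))) (fun s => 2 * K * C * exp (4 * K * s))
      0 t _ _ Ht _ _ _).
    + intros s Hs. change (Rabs (F i s (z true (Rabs s)) (z false (Rabs s)) -
        F i s (w true (Rabs s)) (w false (Rabs s))) <= 2 * K * C * exp (4 * K * s)).
      eapply Rle_trans; [apply HLip|].
      rewrite (Rabs_pos_eq s) by lra.
      generalize (Hzw true s (proj1 Hs)), (Hzw false s (proj1 Hs)). intros H1 H2.
      replace (2 * K * C * exp (4 * K * s)) with
        (K * (C * exp (4 * K * s) + C * exp (4 * K * s))) by ring.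
      apply Rmult_le_compat_l; lra.
    + apply @RInt_correct, @ex_RInt_minus; auto.
    + apply is_RInt_exp_scal. lra.
  - replace (2 * K * C / (4 * K)) with (C / 2) by (field; lra).
    apply Rmult_le_compat_l; lra.
Qed.

Lemma picard_iter_step n i t : 0 <= t ->
  Rabs (picard_iter (S n) i t - picard_iter n i t)
    <= B / (4 * K) * (/ 2) ^ n * exp (4 * K * t).
Proof.
  assert (B0 : 0 <= B) by (eapply Rle_trans; [apply Rabs_pos | apply (HB true 0)]).
  revert i t; induction n as [|n IH]; intros i t Ht.
  - simpl. unfold picard_map.
    rewrite Rplus_minus_l.
    eapply Rle_trans.
    + apply (abs_RInt_le_const _ 0 t B Ht).
      * apply @ex_RInt_continuous; auto.
      * auto.
    (* The first increment is at most B t, and 4 K t <= exp(4 K t) brings it into the weighted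
       norm. *)
    + replace ((t - 0) * B) with (B / (4 * K) * 1 * (4 * K * t)) by (field; lra).
      apply Rmult_le_compat_l.
      * rewrite Rmult_1_r. apply Rmult_le_pos; [lra|].
        apply Rlt_le, Rinv_0_lt_compat; lra.
      * generalize (exp_ineq1_le (4 * K * t)); lra.
  - change (picard_iter (S (S n))) with (picard_map (picard_iter (S n))).
    change (picard_iter (S n) i t) with (picard_map (picard_iter n) i t).
    replace (B / (4 * K) * (/ 2) ^ S n) with (B / (4 * K) * (/ 2) ^ n / 2)
      by (simpl; field; lra).
    apply picard_map_contract; auto.
    + intros j; apply (continuous_comp_Rabs _ (picard_iter_continuous (S n) j)).
    + intros j; apply (continuous_comp_Rabs _ (picard_iter_continuous n j)).
Qed.

Lemma picard_iter_cauchy n k i t : 0 <= t ->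
  Rabs (picard_iter (n + k) i t - picard_iter n i t)
    <= B / (2 * K) * (/ 2) ^ n * exp (4 * K * t).
Proof.
  intros Ht.
  assert (B0 : 0 <= B) by (eapply Rle_trans; [apply Rabs_pos | apply (HB true 0)]).
  set (D := B / (4 * K) * (/ 2) ^ n * exp (4 * K * t)).
  assert (HD : 0 <= D).
  { unfold D. repeat apply Rmult_le_pos; try lra.
    - apply Rlt_le, Rinv_0_lt_compat; lra.
    - apply pow_le; lra.
    - apply Rlt_le, exp_pos. }
  (* The factor 1 - 2^-k is the partial geometric sum, kept so that the induction on [k] closes. *)
  assert (H : Rabs (picard_iter (n + k) i t - picard_iter n i t)
               <= 2 * D * (1 - (/ 2) ^ k)).
  { induction k as [|k IH].
    - rewrite Nat.add_0_r, Rminus_diag, Rabs_R0. simpl. lra.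
    - rewrite Nat.add_succ_r.
      replace (_ - _) with ((picard_iter (S (n + k)) i t - picard_iter (n + k) i t) +
        (picard_iter (n + k) i t - picard_iter n i t)) by ring.
      eapply Rle_trans; [apply Rabs_triang|].
      generalize (picard_iter_step (n + k) i t Ht). rewrite pow_add.
      replace (B / (4 * K) * ((/ 2) ^ n * (/ 2) ^ k) * exp (4 * K * t)) with
        (D * (/ 2) ^ k) by (unfold D; ring).
      simpl ((/ 2) ^ S k). lra. }
  eapply Rle_trans; [exact H|].
  replace (B / (2 * K) * (/ 2) ^ n * exp (4 * K * t)) with (2 * D)
    by (unfold D; field; lra).
  assert (0 <= (/ 2) ^ k) by (apply pow_le; lra). nra.
Qed.

Lemma geometric_small (C : R) (eps : posreal) : exists n, C * (/ 2) ^ n < eps.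
Proof.
  set (k := Rabs C + 1).
  assert (Hk : 0 < k) by (unfold k; generalize (Rabs_pos C); lra).
  destruct (pow_lt_1_zero (/ 2)) with (y := eps / k) as [N HN].
  - rewrite Rabs_pos_eq; lra.
  - apply Rdiv_lt_0_compat; [apply cond_pos | exact Hk].
  - exists N. specialize (HN N (le_n _)).
    rewrite Rabs_pos_eq in HN by (apply pow_le; lra).
    apply (Rmult_lt_compat_l k) in HN; [|exact Hk].
    replace (k * (eps / k)) with (pos eps) in HN by (field; lra).
    assert (0 <= (/ 2) ^ N) by (apply pow_le; lra).
    generalize (Rle_abs C). unfold k in *. nra.
Qed.

Definition picard_lim (i : bool) (t : R) : R := real (Lim_seq (fun n => picard_iter n i t)).

Lemma picard_lim_rate n i t : 0 <= t ->
  Rabs (picard_lim i t - picard_iter n i t)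
    <= B / (2 * K) * (/ 2) ^ n * exp (4 * K * t).
Proof.
  intros Ht.
  assert (H : is_lim_seq (fun n => picard_iter n i t) (picard_lim i t)).
  { apply Lim_seq_correct', ex_lim_seq_cauchy_corr. intros eps.
    destruct (geometric_small (B / (2 * K) * exp (4 * K * t) * 2) eps) as [N HN].
    assert (P : 0 <= B / (2 * K) * exp (4 * K * t) * (/ 2) ^ N).
    { eapply Rle_trans; [apply Rabs_pos|].
      generalize (picard_iter_cauchy N 0 i t Ht). intros H. eapply Rle_trans; [exact H|].
      apply Req_le; ring. }
    exists N; intros l m Hl Hm.
    generalize (picard_iter_cauchy N (l - N) i t Ht), (picard_iter_cauchy N (m - N) i t Ht).
    replace (N + (l - N))%nat with l by (rewrite Nat.add_comm, Nat.sub_add; auto).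
    replace (N + (m - N))%nat with m by (rewrite Nat.add_comm, Nat.sub_add; auto).
    intros H1 H2.
    replace (_ - _) with ((picard_iter l i t - picard_iter N i t) -
      (picard_iter m i t - picard_iter N i t)) by ring.
    unfold Rminus at 1. eapply Rle_lt_trans; [apply Rabs_triang|].
    rewrite Rabs_Ropp. lra. }
  apply (is_lim_seq_incr_n _ n) in H.
  assert (H2 : is_lim_seq (fun k => Rabs (picard_iter (k + n) i t - picard_iter n i t))
     (Rabs (picard_lim i t - picard_iter n i t))).
  { apply (is_lim_seq_abs _ (picard_lim i t - picard_iter n i t)).
    apply is_lim_seq_minus'; [exact H | apply is_lim_seq_const]. }
  apply (is_lim_seq_le _ _ (Rabs (picard_lim i t - picard_iter n i t))
    (B / (2 * K) * (/ 2) ^ n * exp (4 * K * t)) ) with (2 := H2) (3 := is_lim_seq_const _).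
  intros k. rewrite Nat.add_comm. apply picard_iter_cauchy, Ht.
Qed.

(** The rate of convergence is uniform on bounded time intervals, so the limit inherits continuity
    from the iterates. *)
Lemma picard_lim_continuous i s : continuous (fun s => picard_lim i (Rabs s)) s.
Proof.
  apply continuous_eps; intros eps He.
  set (M := exp (4 * K * (Rabs s + 1))).
  destruct (geometric_small (B / (2 * K) * M * 4) (mkposreal eps He)) as [n Hn].
  simpl in Hn.
  generalize (proj1 (continuous_eps _ _)
    (continuous_comp_Rabs _ (picard_iter_continuous n i) s) (eps / 2) ltac:(lra)).
  intros H1.
  assert (H2 : locally s (fun u => Rabs (u - s) < 1))
    by (exists (mkposreal 1 Rlt_0_1); intros u Hu; exact Hu).
  generalize (filter_and _ _ H1 H2). apply filter_imp; intros u [U1 U2].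
  assert (Hrate : forall w, Rabs w <= Rabs s + 1 ->
     Rabs (picard_lim i (Rabs w) - picard_iter n i (Rabs w))
       <= B / (2 * K) * (/ 2) ^ n * M).
  { intros w Hw. eapply Rle_trans; [apply picard_lim_rate, Rabs_pos|].
    apply Rmult_le_compat_l.
    - generalize (picard_iter_cauchy n 0 i 0 (Rle_refl _)).
      rewrite Rmult_0_r, exp_0, Rmult_1_r. apply Rle_trans, Rabs_pos.
    - unfold M. destruct (Req_dec (Rabs w) (Rabs s + 1)) as [->|]; [lra|].
      apply Rlt_le, exp_increasing. apply Rmult_lt_compat_l; lra. }
  generalize (Hrate s ltac:(lra)).
  assert (Hu : Rabs u <= Rabs s + 1).
  { replace u with (s + (u - s)) by ring. eapply Rle_trans; [apply Rabs_triang|]. lra. }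
  generalize (Hrate u Hu). intros A1 A2.
  replace (picard_lim i (Rabs u) - picard_lim i (Rabs s)) with
    ((picard_lim i (Rabs u) - picard_iter n i (Rabs u)) +
     ((picard_iter n i (Rabs u) - picard_iter n i (Rabs s)) -
      (picard_lim i (Rabs s) - picard_iter n i (Rabs s)))) by ring.
  eapply Rle_lt_trans; [apply Rabs_triang|].
  unfold Rminus at 2. eapply Rle_lt_trans; [apply Rplus_le_compat_l, Rabs_triang|].
  rewrite Rabs_Ropp. lra.
Qed.

Lemma picard_lim_fixed i t : 0 <= t -> picard_lim i t = picard_map picard_lim i t.
Proof.
  intros Ht. apply cond_eq. intros eps He.
  set (M := B / (2 * K)).
  destruct (geometric_small (M * exp (4 * K * t)) (mkposreal eps He)) as [n Hn].
  simpl in Hn.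
  generalize (picard_lim_rate (S n) i t Ht). intros H1.
  assert (H2 : Rabs (picard_map picard_lim i t - picard_map (picard_iter n) i t)
     <= M * (/ 2) ^ n / 2 * exp (4 * K * t)).
  { apply picard_map_contract; auto.
    - intros j; apply picard_lim_continuous.
    - intros j; apply (continuous_comp_Rabs _ (picard_iter_continuous n j)).
    - intros; apply picard_lim_rate; auto. }
  change (picard_iter (S n) i t) with (picard_map (picard_iter n) i t) in H1.
  fold M in H1. simpl ((/ 2) ^ S n) in H1.
  replace (_ - _) with ((picard_lim i t - picard_map (picard_iter n) i t) -
    (picard_map picard_lim i t - picard_map (picard_iter n) i t)) by ring.
  unfold Rminus at 1. eapply Rle_lt_trans; [apply Rabs_triang|].
  rewrite Rabs_Ropp. lra.
Qed.

Lemma picard_exists :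
  exists z : bool -> R -> R,
    (forall i, z i 0 = z0 i) /\
    (forall i t, 0 <= t -> is_derive (z i) t (F i t (z true t) (z false t))).
Proof.
  (* The witness is the image of the limit rather than the limit itself: the two agree on [0, oo),
     but the image is visibly differentiable on both sides of 0. *)
  exists (picard_map picard_lim). split.
  - intros i. unfold picard_map. rewrite RInt_point. apply Rplus_0_r.
  - intros i t Ht. rewrite <- !picard_lim_fixed by exact Ht.
    generalize (picard_map_derive picard_lim i t
      (fun j s => picard_lim_continuous j s)).
    rewrite (Rabs_pos_eq t Ht). auto.
Qed.

End Picard.

(** * Averaging over one period *)

(** The point returned by [MVT_gen] may be an endpoint, where [df] need not be a derivative. Setting
    the derivative to 0 there leaves the alternative c = 0, which is harmless for bounds and for
    signs. *)
Lemma mvt_open (f df : R -> R) (a b : R) :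
  a < b ->
  (forall x, a <= x <= b -> continuous f x) ->
  (forall x, a < x < b -> is_derive f x (df x)) ->
  exists c, f b - f a = c * (b - a) /\ (c = 0 \/ exists x, a < x < b /\ c = df x).
Proof.
  intros Hab Hc Hd.
  set (dg := fun x => if Rlt_dec a x then if Rlt_dec x b then df x else 0 else 0).
  destruct (MVT_gen f a b dg) as (c & _ & Hc2).
  - rewrite Rmin_left, Rmax_right by lra. intros x Hx. unfold dg.
    destruct (Rlt_dec a x); [|lra]. destruct (Rlt_dec x b); [|lra]. auto.
  - rewrite Rmin_left, Rmax_right by lra. intros x Hx.
    apply continuity_pt_filterlim, Hc, Hx.
  - exists (dg c). split; [exact Hc2|].
    unfold dg. destruct (Rlt_dec a c); auto. destruct (Rlt_dec c b); auto.
    right. exists c. auto.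
Qed.

Lemma mvt_bound (f df : R -> R) (a b M : R) :
  a <= b -> 0 <= M ->
  (forall x, a <= x <= b -> continuous f x) ->
  (forall x, a < x < b -> is_derive f x (df x) /\ Rabs (df x) <= M) ->
  Rabs (f b - f a) <= M * (b - a).
Proof.
  intros [Hab| ->] HM Hc Hd.
  - destruct (mvt_open f df a b Hab Hc (fun x Hx => proj1 (Hd x Hx)))
      as (c & -> & [-> | (x & Hx & ->)]).
    + rewrite Rmult_0_l, Rabs_R0. apply Rmult_le_pos; lra.
    + rewrite Rabs_mult, (Rabs_pos_eq (b - a)) by lra.
      apply Rmult_le_compat_r; [lra|]. apply Hd, Hx.
  - rewrite Rminus_diag, Rabs_R0. lra.
Qed.

Lemma continuous_gt_near (f : R -> R) (x c : R) :
  continuous f x -> c < f x -> exists eps, 0 < eps /\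
    forall y, Rabs (y - x) < eps -> c < f y.
Proof.
  intros Hf Hc.
  destruct (proj1 (continuous_eps f x) Hf (f x - c) ltac:(lra)) as [eps He].
  exists eps; split; [apply cond_pos|]. intros y Hy.
  specialize (He y Hy). apply Rabs_def2 in He. lra.
Qed.

Lemma last_crossing (f : R -> R) (a b c : R) :
  a <= b -> (forall x, a <= x <= b -> continuous f x) ->
  f a <= c -> c < f b ->
  exists s, a <= s < b /\ f s = c /\ forall x, s < x <= b -> c < f x.
Proof.
  intros Hab Hf Ha Hb.
  destruct (completeness (fun s => a <= s <= b /\ f s <= c)) as [s [Hs1 Hs2]].
  - exists b. intros x [Hx _]. lra.
  - exists a. split; [lra | exact Ha].
  - assert (Has : a <= s) by (apply Hs1; split; [lra | exact Ha]).
    assert (Hsb : s <= b) by (apply Hs2; intros x [Hx _]; lra).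
    assert (Hgt : forall x, s < x <= b -> c < f x).
    { intros x Hx. apply Rnot_le_lt. intros Hfx.
      assert (x <= s) by (apply Hs1; split; [lra | exact Hfx]). lra. }
    assert (Hle : f s <= c).
    { apply Rnot_lt_le. intros Hlt.
      destruct (continuous_gt_near f s c (Hf s (conj Has Hsb)) Hlt) as (eps & He & Hn).
      assert (s <= s - eps / 2); [|lra].
      apply Hs2. intros x [Hx Hfx]. apply Rnot_lt_le. intros Hlt2.
      assert (x <= s) by (apply Hs1; split; [lra | exact Hfx]).
      assert (c < f x); [|lra]. apply Hn. rewrite Rabs_left1; lra. }
    assert (Hne : s <> b) by (intros ->; lra).
    exists s. split; [lra|]. split; [|exact Hgt].
    apply Rle_antisym; [exact Hle|]. apply Rnot_lt_le. intros Hlt.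
    destruct (continuous_gt_near (fun x => - f x) s (- c)) as (eps & He & Hn).
    + apply (continuous_opp f), Hf; lra.
    + lra.
    + set (x := Rmin (s + eps / 2) b).
      assert (Hx : s < x) by (unfold x; apply Rmin_glb_lt; lra).
      assert (x <= s + eps / 2) by apply Rmin_l.
      assert (x <= b) by apply Rmin_r.
      generalize (Hgt x ltac:(lra)).
      assert (- c < - f x); [|lra]. apply Hn. rewrite Rabs_pos_eq; lra.
Qed.

Lemma barrier (f df : R -> R) (t c : R) :
  0 <= t ->
  (forall x, 0 <= x <= t -> continuous f x) ->
  (forall x, 0 < x < t -> is_derive f x (df x)) ->
  (forall x, 0 < x < t -> c < f x -> df x <= 0) ->
  f 0 <= c -> f t <= c.
Proof.
  intros Ht Hc Hd Hneg H0. apply Rnot_lt_le. intros Hlt.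
  destruct (last_crossing f 0 t c Ht Hc H0 Hlt) as (s & Hs & Hfs & Hgt).
  destruct (mvt_open f df s t ltac:(lra)) as (k & Hk & Hk2).
  - intros; apply Hc; lra.
  - intros; apply Hd; lra.
  - assert (k <= 0).
    { destruct Hk2 as [-> | (x & Hx & ->)]; [lra|].
      apply Hneg; [lra|]. apply Hgt; lra. }
    nra.
Qed.

(** Continuous induction: if the weak bound up to any time gives the strict bound at that time, then
    the first time at which the level c is reached cannot exist. *)
Lemma bootstrap (g : R -> R) (t c : R) :
  0 <= t ->
  (forall x, 0 <= x <= t -> continuous g x) ->
  g 0 <= c ->
  (forall u, 0 <= u <= t -> (forall x, 0 <= x <= u -> g x <= c) -> g u < c) ->
  g t < c.
Proof.
  intros Ht Hc H0 Hstep.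
  assert (H0' : g 0 < c).
  { apply Hstep; [lra|]. intros x Hx. replace x with 0 by lra. exact H0. }
  apply Rnot_le_lt. intros Hge.
  (* Reversing time and sign turns the last crossing into the first time at which [g] reaches c. *)
  destruct (last_crossing (fun x => - g (t - x)) 0 t (- c) Ht) as (s & Hs & Hgs & Hgt).
  - intros x Hx. apply (continuous_opp (fun x => g (t - x))).
    apply (continuous_comp (fun x => t - x) g).
    + apply (continuous_minus (fun _ => t) (fun x => x));
        [apply continuous_const | apply continuous_id].
    + apply Hc. lra.
  - rewrite Rminus_0_r. lra.
  - rewrite Rminus_diag. lra.
  - assert (g (t - s) < c); [|lra].
    apply Hstep; [lra|]. intros x Hx.
    destruct (Req_dec x (t - s)) as [->|Hne]; [lra|].
    generalize (Hgt (t - x) ltac:(lra)). replace (t - (t - x)) with x by ring. lra.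
Qed.

(** * The dither and integrals over its period *)

Lemma dither_bound t : Rabs (dither t) <= 1.
Proof. apply Rabs_le, SIN_bound. Qed.

Lemma continuous_dither t : continuous dither t.
Proof.
  apply @ex_derive_continuous. unfold dither. auto_derive. trivial.
Qed.

Lemma dither_half t : dither (t + / 2) = - dither t.
Proof.
  unfold dither. replace (2 * PI * (t + / 2)) with (2 * PI * t + PI) by field.
  apply neg_sin.
Qed.

Lemma dither_periodic t n : dither (t + INR n) = dither t.
Proof.
  unfold dither. replace (2 * PI * (t + INR n)) with (2 * PI * t + 2 * INR n * PI) by ring.
  apply sin_period.
Qed.

Lemma dither_pos t : 0 <= t <= / 2 -> 0 <= dither t.
Proof.
  intros Ht. generalize PI_RGT_0; intros Hpi. unfold dither. apply sin_ge_0; nra.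
Qed.

Lemma RInt_shift (g : R -> R) (a b s : R) :
  (forall x, continuous g x) -> RInt (fun t => g (t + s)) a b = RInt g (a + s) (b + s).
Proof.
  intros Hg.
  assert (E : ex_RInt g (1 * a + s) (1 * b + s)) by (apply @ex_RInt_continuous; auto).
  generalize (RInt_comp_lin g 1 s a b E).
  rewrite !Rmult_1_l. intros <-.
  apply RInt_ext. intros x _. unfold scal; simpl. unfold mult; simpl.
  rewrite !Rmult_1_l. reflexivity.
Qed.

Lemma ex_RInt_cont (g : R -> R) (a b : R) : (forall x, continuous g x) -> ex_RInt g a b.
Proof. intros; apply @ex_RInt_continuous; auto. Qed.

Lemma RInt_sub (f g : R -> R) (a b : R) :
  ex_RInt f a b -> ex_RInt g a b ->
  RInt (fun t => f t - g t) a b = RInt f a b - RInt g a b :> R.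
Proof. intros; apply (RInt_minus f g); assumption. Qed.

Lemma RInt_mult_l (k : R) (f : R -> R) (a b : R) :
  ex_RInt f a b -> RInt (fun t => k * f t) a b = k * RInt f a b :> R.
Proof. intros; apply (RInt_scal f a b k); assumption. Qed.

Lemma ex_RInt_sub (f g : R -> R) (a b : R) :
  ex_RInt f a b -> ex_RInt g a b -> ex_RInt (fun t => f t - g t) a b.
Proof. intros; apply (ex_RInt_minus f g); assumption. Qed.

Lemma ex_RInt_mult_l (k : R) (f : R -> R) (a b : R) :
  ex_RInt f a b -> ex_RInt (fun t => k * f t) a b.
Proof. intros; apply (ex_RInt_scal f a b k); assumption. Qed.

Lemma RInt_cst (c a b : R) : RInt (fun _ => c) a b = (b - a) * c :> R.
Proof. apply (RInt_const a b c). Qed.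

Lemma RInt_period (g : R -> R) (n : nat) :
  (forall x, continuous g x) -> (forall t, g (t + INR n) = g t) ->
  RInt g (INR n) (INR n + 1) = RInt g 0 1.
Proof.
  intros Hg Hp.
  replace (RInt g (INR n) (INR n + 1)) with (RInt g (0 + INR n) (1 + INR n))
    by (f_equal; ring).
  rewrite <- RInt_shift by exact Hg. apply RInt_ext. intros; apply Hp.
Qed.

Lemma RInt_halves (g : R -> R) :
  (forall x, continuous g x) ->
  RInt g 0 1 = RInt (fun t => g t + g (t + / 2)) 0 (/ 2).
Proof.
  intros Hg.
  assert (Hg2 : forall x, continuous (fun t => g (t + / 2)) x).
  { intros x. apply (continuous_comp (fun t => t + / 2) g); [|apply Hg].
    apply (continuous_plus (fun t => t) (fun _ => / 2));
      [apply continuous_id | apply continuous_const]. }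
  rewrite (RInt_plus g (fun t => g (t + / 2))) by (apply ex_RInt_cont; assumption).
  rewrite RInt_shift by exact Hg.
  replace (0 + / 2) with (/ 2) by ring. replace (/ 2 + / 2) with 1 by field.
  symmetry. apply (RInt_Chasles g); apply ex_RInt_cont; exact Hg.
Qed.

(** * Averages of h over the dither *)

Section Averages.

Variables (h : R -> R) (delta : R).
Hypothesis Hh : forall x, continuous h x.
Hypothesis Hdelta : 0 < delta.

(** Halves of the Fourier coefficients. In slow time (gamma = 1) the average system is x' = -
    [avg_v] x, y' = [avg_a] x - y. *)
Definition avg_a (x : R) : R := RInt (fun t => h (x + delta * dither t)) 0 1.
Definition avg_v (x : R) : R := RInt (fun t => h (x + delta * dither t) * dither t) 0 1.

Lemma continuous_shifted x t : continuous (fun t => h (x + delta * dither t)) t.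
Proof.
  apply (continuous_comp (fun t => x + delta * dither t) h); [|apply Hh].
  apply (continuous_plus (fun _ => x) (fun t => delta * dither t)).
  - apply continuous_const.
  - apply (continuous_scal_r delta dither), continuous_dither.
Qed.

Lemma continuous_shifted_mult x t :
  continuous (fun t => h (x + delta * dither t) * dither t) t.
Proof.
  apply (continuous_mult (fun t => h (x + delta * dither t)) dither).
  - apply continuous_shifted.
  - apply continuous_dither.
Qed.

Variables (D : R -> Prop) (L : R).
Hypothesis HL : lipschitz_on D L h.
Hypothesis HL0 : 0 <= L.

Definition inside (x : R) : Prop := forall s, Rabs s <= 1 -> D (x + delta * s).

Lemma shifted_lipschitz x y s : inside x -> inside y -> Rabs s <= 1 ->
  Rabs (h (x + delta * s) - h (y + delta * s)) <= L * Rabs (x - y).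
Proof.
  intros Hx Hy Hs. eapply Rle_trans; [apply HL; auto|]. apply Req_le.
  do 2 f_equal. ring.
Qed.

Lemma avg_a_lipschitz : lipschitz_on inside L avg_a.
Proof.
  intros x y Hx Hy. unfold avg_a.
  rewrite <- RInt_sub by (apply ex_RInt_cont, continuous_shifted).
  replace (L * Rabs (x - y)) with ((1 - 0) * (L * Rabs (x - y))) by ring.
  apply abs_RInt_le_const; [lra| |].
  - apply ex_RInt_sub; apply ex_RInt_cont, continuous_shifted.
  - intros t _. apply shifted_lipschitz; auto. apply dither_bound.
Qed.

Lemma avg_v_lipschitz : lipschitz_on inside L avg_v.
Proof.
  intros x y Hx Hy. unfold avg_v.
  rewrite <- RInt_sub by (apply ex_RInt_cont, continuous_shifted_mult).
  replace (L * Rabs (x - y)) with ((1 - 0) * (L * Rabs (x - y))) by ring.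
  apply abs_RInt_le_const; [lra| |].
  - apply ex_RInt_sub; apply ex_RInt_cont, continuous_shifted_mult.
  - intros t _.
    rewrite <- Rmult_minus_distr_r, Rabs_mult.
    generalize (shifted_lipschitz x y (dither t) Hx Hy (dither_bound t)), (dither_bound t),
      (Rabs_pos (h (x + delta * dither t) - h (y + delta * dither t))),
      (Rabs_pos (dither t)). nra.
Qed.

Lemma avg_a_close x s : inside x -> Rabs s <= 1 ->
  Rabs (h (x + delta * s) - avg_a x) <= 2 * L * delta.
Proof.
  intros Hx Hs. unfold avg_a.
  assert (E : RInt (fun t => h (x + delta * s) - h (x + delta * dither t)) 0 1
    = h (x + delta * s) - RInt (fun t => h (x + delta * dither t)) 0 1).
  { rewrite (RInt_sub (fun _ => h (x + delta * s))).
    - rewrite RInt_cst, Rminus_0_r, Rmult_1_l. reflexivity.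
    - apply ex_RInt_const.
    - apply ex_RInt_cont, continuous_shifted. }
  rewrite <- E.
  replace (2 * L * delta) with ((1 - 0) * (2 * L * delta)) by ring.
  apply abs_RInt_le_const; [lra| |].
  - apply ex_RInt_sub; [apply ex_RInt_const | apply ex_RInt_cont, continuous_shifted].
  - intros t _.
    eapply Rle_trans; [apply HL; auto; apply Hx, dither_bound|].
    replace (x + delta * s - (x + delta * dither t)) with (delta * (s - dither t)) by ring.
    rewrite Rabs_mult, (Rabs_pos_eq delta) by lra.
    assert (Rabs (s - dither t) <= 2).
    { unfold Rminus. eapply Rle_trans; [apply Rabs_triang|]. rewrite Rabs_Ropp.
      generalize (dither_bound t); lra. }
    replace (2 * L * delta) with (L * (delta * 2)) by ring.
    apply Rmult_le_compat_l, Rmult_le_compat_l; lra.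
Qed.

Lemma RInt_dither : RInt dither 0 1 = 0 :> R.
Proof.
  rewrite RInt_halves by apply continuous_dither.
  rewrite (RInt_ext _ (fun _ => 0)).
  - rewrite RInt_const. apply Rmult_0_r.
  - intros x _. rewrite dither_half. apply Rplus_opp_r.
Qed.

(** The dither has mean 0, so h may be replaced by h - h(x) under the integral. Thus only the
    variation of h counts and no bound on |h| enters. *)
Lemma avg_v_bound x : inside x -> Rabs (avg_v x) <= L * delta.
Proof.
  intros Hx.
  assert (E : avg_v x = RInt (fun t => h (x + delta * dither t) * dither t - h x * dither t) 0 1).
  { rewrite RInt_sub.
    - rewrite RInt_mult_l, RInt_dither by (apply ex_RInt_cont, continuous_dither).
      unfold avg_v. rewrite Rmult_0_r, Rminus_0_r. reflexivity.
    - apply ex_RInt_cont, continuous_shifted_mult.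
    - apply ex_RInt_mult_l, ex_RInt_cont, continuous_dither. }
  rewrite E.
  replace (L * delta) with ((1 - 0) * (L * delta)) by ring.
  apply abs_RInt_le_const; [lra| |].
  - apply ex_RInt_sub; [apply ex_RInt_cont, continuous_shifted_mult|].
    apply ex_RInt_mult_l, ex_RInt_cont, continuous_dither.
  - intros t _.
    rewrite <- Rmult_minus_distr_r, Rabs_mult.
    assert (Hx0 : D x).
    { replace x with (x + delta * 0) by ring. apply Hx. rewrite Rabs_R0. lra. }
    generalize (HL _ _ (Hx _ (dither_bound t)) Hx0).
    replace (x + delta * dither t - x) with (delta * dither t) by ring.
    rewrite Rabs_mult, (Rabs_pos_eq delta) by lra.
    set (A := Rabs (h _ - h x)). intros H1.
    generalize (dither_bound t), (Rabs_pos (dither t)). set (w := Rabs (dither t)).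
    intros H2 H3. fold w in H1.
    assert (H4 : A <= L * delta).
    { eapply Rle_trans; [exact H1|]. apply Rmult_le_compat_l; [exact HL0|].
      nra. }
    assert (H5 : 0 <= A) by apply Rabs_pos.
    replace (L * delta) with (L * delta * 1) by ring.
    apply Rmult_le_compat; lra.
Qed.

(** * A single period of the perturbed system *)

Section OnePeriod.

Variables (gamma E : R) (n : nat) (tau : R) (x y : R -> R).
Hypothesis Hgamma : 0 < gamma.
Hypothesis HgL : gamma * (L + 1) <= / 2.
Hypothesis Htau : 0 <= tau <= 1.

Let f (s : R) : R := h (x s + delta * dither s) - y s.
Let bound : R := 2 * (2 * L * delta + E).

Hypothesis Hxc : forall s, INR n <= s <= INR n + tau -> continuous x s.
Hypothesis Hyc : forall s, INR n <= s <= INR n + tau -> continuous y s.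
Hypothesis Hxd : forall s, INR n < s < INR n + tau ->
  is_derive x s (- gamma * (h (x s + delta * dither s) - y s) * dither s).
Hypothesis Hyd : forall s, INR n < s < INR n + tau ->
  is_derive y s (gamma * (h (x s + delta * dither s) - y s)).
Hypothesis Hin : forall s, INR n <= s <= INR n + tau -> inside (x s).
Hypothesis HE : Rabs (y (INR n) - avg_a (x (INR n))) <= E.

(** Let M be the maximum of |h(x + delta u) - y| on the interval. The state moves by at most gamma
    M, which in turn gives M <= 2 L delta + E + gamma (L + 1) M; as gamma (L + 1) <= 1/2, the last
    term is absorbed and M <= [bound]. Here [tau] is a length of at most one period, so that times
    between grid points are covered too. *)
Lemma one_period_drift s : INR n <= s <= INR n + tau ->
  Rabs (x s - x (INR n)) <= gamma * bound /\ Rabs (y s - y (INR n)) <= gamma * bound.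
Proof.
  assert (Hfc : forall s, INR n <= s <= INR n + tau -> continuous (fun s => Rabs (f s)) s).
  { intros u Hu. apply (continuous_comp f Rabs); [|apply continuous_Rabs_id].
    apply (continuous_minus (fun s => h (x s + delta * dither s)) y); [|auto].
    apply (continuous_comp (fun s => x s + delta * dither s) h); [|apply Hh].
    apply (continuous_plus x (fun s => delta * dither s)); [auto|].
    apply (continuous_scal_r delta dither), continuous_dither. }
  destruct (continuity_ab_maj (fun s => Rabs (f s)) (INR n) (INR n + tau)) as (mx & Hmx & Hmxi).
  { lra. }
  { intros; apply continuity_pt_filterlim, Hfc; auto. }
  set (M := Rabs (f mx)) in *.
  assert (HM : 0 <= M) by apply Rabs_pos.
  assert (Hdev : forall s, INR n <= s <= INR n + tau ->
    Rabs (x s - x (INR n)) <= gamma * M /\ Rabs (y s - y (INR n)) <= gamma * M).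
  { intros u Hu.
    assert (gamma * M * (u - INR n) <= gamma * M).
    { rewrite <- (Rmult_1_r (gamma * M)) at 2. apply Rmult_le_compat_l; [nra | lra]. }
    assert (Hf : forall s, INR n < s < u -> Rabs (f s) <= M) by (intros; apply Hmx; lra).
    split; (eapply Rle_trans; [|eassumption]).
    - apply (mvt_bound x (fun s => - gamma * (h (x s + delta * dither s) - y s) * dither s));
        [lra | nra | intros; apply Hxc; lra |].
      intros w Hw. split; [apply Hxd; lra|].
      rewrite !Rabs_mult, Rabs_Ropp, (Rabs_pos_eq gamma) by lra.
      generalize (Hf w Hw), (dither_bound w), (Rabs_pos (dither w)), (Rabs_pos (f w)).
      fold (f w). intros.
      rewrite <- (Rmult_1_r (gamma * M)). apply Rmult_le_compat; nra.
    - apply (mvt_bound y (fun s => gamma * (h (x s + delta * dither s) - y s)));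
        [lra | nra | intros; apply Hyc; lra |].
      intros w Hw. split; [apply Hyd; lra|].
      rewrite !Rabs_mult, (Rabs_pos_eq gamma) by lra.
      generalize (Hf w Hw). fold (f w). intros. apply Rmult_le_compat_l; lra. }
  assert (HMb : M <= bound).
  { destruct (Hdev mx Hmxi) as [H1 H2].
    assert (Hn : INR n <= INR n <= INR n + tau) by lra.
    generalize (shifted_lipschitz (x mx) (x (INR n)) (dither mx) (Hin _ Hmxi) (Hin _ Hn)
      (dither_bound mx)).
    generalize (avg_a_close (x (INR n)) (dither mx) (Hin _ Hn) (dither_bound mx)).
    intros H3 H4.
    assert (H5 : L * Rabs (x mx - x (INR n)) <= L * (gamma * M))
      by (apply Rmult_le_compat_l; lra).
    assert (H6 : M <= L * (gamma * M) + 2 * L * delta + E + gamma * M).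
    { unfold M at 1, f.
      replace (h (x mx + delta * dither mx) - y mx) with
        ((h (x mx + delta * dither mx) - h (x (INR n) + delta * dither mx)) +
         ((h (x (INR n) + delta * dither mx) - avg_a (x (INR n))) +
          (- (y (INR n) - avg_a (x (INR n))) + - (y mx - y (INR n))))) by ring.
      eapply Rle_trans; [apply Rabs_triang|].
      eapply Rle_trans; [apply Rplus_le_compat_l, Rabs_triang|].
      eapply Rle_trans; [apply Rplus_le_compat_l, Rplus_le_compat_l, Rabs_triang|].
      rewrite !Rabs_Ropp. lra. }
    unfold bound. nra. }
  intros Hs. destruct (Hdev s Hs).
  assert (gamma * M <= gamma * bound) by (apply Rmult_le_compat_l; lra). lra.
Qed.

Let avg_integral (g : R -> R) (t : R) : R := RInt g (INR n) t.

Lemma avg_integral_derive (g : R -> R) (t : R) :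
  (forall s, continuous g s) -> is_derive (avg_integral g) t (g t).
Proof.
  intros Hg. apply (is_derive_RInt g _ (INR n)); [|apply Hg].
  apply filter_forall. intros u. apply @RInt_correct, ex_RInt_cont, Hg.
Qed.

Hypothesis Htau1 : tau = 1.

(* Over a full period the frozen field integrates exactly to the average
   field, so only the variation of the state within the period contributes. *)
Lemma one_period_step :
  Rabs (x (INR n + 1) - x (INR n) + gamma * avg_v (x (INR n)))
    <= (L + 1) * bound * gamma ^ 2 /\
  Rabs (y (INR n + 1) - y (INR n) - gamma * (avg_a (x (INR n)) - y (INR n)))
    <= (L + 1) * bound * gamma ^ 2.
Proof.
  set (xn := x (INR n)). set (yn := y (INR n)).
  assert (Hn : INR n <= INR n <= INR n + tau) by lra.
  assert (Hb : 0 <= bound).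
  { destruct (one_period_drift _ Hn) as [H _]. rewrite Rminus_diag, Rabs_R0 in H. nra. }
  assert (Hdiff : forall s, INR n <= s <= INR n + tau ->
    Rabs ((h (x s + delta * dither s) - y s) - (h (xn + delta * dither s) - yn))
      <= (L + 1) * bound * gamma).
  { intros s Hs. destruct (one_period_drift s Hs) as [H1 H2].
    generalize (shifted_lipschitz (x s) xn (dither s) (Hin _ Hs) (Hin _ Hn) (dither_bound s)).
    intros H3. fold xn in H1. fold yn in H2.
    replace ((h (x s + delta * dither s) - y s) - (h (xn + delta * dither s) - yn)) with
     ((h (x s + delta * dither s) - h (xn + delta * dither s)) + - (y s - yn)) by ring.
    eapply Rle_trans; [apply Rabs_triang|]. rewrite Rabs_Ropp.
    assert (L * Rabs (x s - xn) <= L * (gamma * bound)) by (apply Rmult_le_compat_l; lra).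
    lra. }
  split.
  - set (g := fun s => (h (xn + delta * dither s) - yn) * dither s).
    assert (Hg : forall s, continuous g s).
    { intros s. apply (continuous_mult (fun s => h (xn + delta * dither s) - yn) dither);
        [|apply continuous_dither].
      apply (continuous_minus (fun s => h (xn + delta * dither s)) (fun _ => yn));
        [apply continuous_shifted | apply continuous_const]. }
    assert (HI : avg_integral g (INR n + 1) = avg_v xn).
    { unfold avg_integral. rewrite RInt_period; [|exact Hg | intros; unfold g; rewrite dither_periodic; auto].
      rewrite (RInt_ext g (fun s => h (xn + delta * dither s) * dither s - yn * dither s))
        by (intros s _; apply Rmult_minus_distr_r).
      rewrite RInt_sub.
      - rewrite RInt_mult_l, RInt_dither by (apply ex_RInt_cont, continuous_dither).
        unfold avg_v. rewrite Rmult_0_r, Rminus_0_r. reflexivity.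
      - apply ex_RInt_cont, continuous_shifted_mult.
      - apply ex_RInt_mult_l, ex_RInt_cont, continuous_dither. }
    assert (HI0 : avg_integral g (INR n) = 0) by apply (RInt_point (INR n) g).
    generalize (mvt_bound (fun t => x t + gamma * avg_integral g t)
      (fun s => - gamma * (h (x s + delta * dither s) - y s) * dither s + gamma * g s)
      (INR n) (INR n + 1) ((L + 1) * bound * gamma ^ 2)).
    cbv beta. rewrite HI, HI0. intros HM.
    replace (_ - _ + _) with (x (INR n + 1) + gamma * avg_v xn - (x (INR n) + gamma * 0))
      by (unfold xn; ring).
    eapply Rle_trans; [apply HM|]; [lra | | | | lra].
    + apply Rmult_le_pos; [nra | apply pow2_ge_0].
    + intros s Hs. apply (continuous_plus x (fun t => gamma * avg_integral g t)).
      * apply Hxc; lra.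
      * apply (continuous_scal_r gamma (avg_integral g)).
        apply @ex_derive_continuous. eexists. apply avg_integral_derive, Hg.
    + intros s Hs. split.
      * apply @is_derive_plus; [apply Hxd; lra|].
        apply (is_derive_scal (avg_integral g)), avg_integral_derive, Hg.
      * unfold g. generalize (Hdiff s ltac:(lra)).
        set (A := h (x s + delta * dither s) - y s).
        set (B := h (xn + delta * dither s) - yn). intros H1.
        replace (- gamma * A * dither s + gamma * (B * dither s)) with
          (- gamma * ((A - B) * dither s)) by ring.
        rewrite Rabs_mult, Rabs_Ropp, Rabs_mult, (Rabs_pos_eq gamma) by lra.
        replace ((L + 1) * bound * gamma ^ 2) with (gamma * ((L + 1) * bound * gamma * 1))
          by ring.
        apply Rmult_le_compat_l; [lra|].
        apply Rmult_le_compat; auto using Rabs_pos, dither_bound.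
  - set (g := fun s => h (xn + delta * dither s) - yn).
    assert (Hg : forall s, continuous g s).
    { intros s.
      apply (continuous_minus (fun s => h (xn + delta * dither s)) (fun _ => yn));
        [apply continuous_shifted | apply continuous_const]. }
    assert (HI : avg_integral g (INR n + 1) = avg_a xn - yn).
    { unfold avg_integral. rewrite RInt_period; [|exact Hg | intros; unfold g; rewrite dither_periodic; auto].
      unfold g. rewrite (RInt_sub (fun s => h (xn + delta * dither s)) (fun _ => yn)).
      - rewrite RInt_cst, Rminus_0_r, Rmult_1_l. reflexivity.
      - apply ex_RInt_cont, continuous_shifted.
      - apply ex_RInt_const. }
    assert (HI0 : avg_integral g (INR n) = 0) by apply (RInt_point (INR n) g).
    generalize (mvt_bound (fun t => y t - gamma * avg_integral g t)
      (fun s => gamma * (h (x s + delta * dither s) - y s) - gamma * g s)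
      (INR n) (INR n + 1) ((L + 1) * bound * gamma ^ 2)).
    cbv beta. rewrite HI, HI0. intros HM.
    replace (_ - _ - _) with (y (INR n + 1) - gamma * (avg_a xn - yn) - (y (INR n) - gamma * 0))
      by (unfold yn; ring).
    eapply Rle_trans; [apply HM|]; [lra | | | | lra].
    + apply Rmult_le_pos; [nra | apply pow2_ge_0].
    + intros s Hs. apply (continuous_minus y (fun t => gamma * avg_integral g t)).
      * apply Hyc; lra.
      * apply (continuous_scal_r gamma (avg_integral g)).
        apply @ex_derive_continuous. eexists. apply avg_integral_derive, Hg.
    + intros s Hs. split.
      * apply @is_derive_minus; [apply Hyd; lra|].
        apply (is_derive_scal (avg_integral g)), avg_integral_derive, Hg.
      * unfold g. generalize (Hdiff s ltac:(lra)).
        set (A := h (x s + delta * dither s) - y s).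
        set (B := h (xn + delta * dither s) - yn). intros H1.
        replace (gamma * A - gamma * B) with (gamma * (A - B)) by ring.
        rewrite Rabs_mult, (Rabs_pos_eq gamma) by lra.
        replace ((L + 1) * bound * gamma ^ 2) with (gamma * ((L + 1) * bound * gamma))
          by ring.
        apply Rmult_le_compat_l; lra.
Qed.

End OnePeriod.
End Averages.

(** * Properties of the average field *)

Lemma smooth_ex_derive (h : R -> R) (x : R) : smooth h -> ex_derive h x.
Proof. intros H. exact (H 1%nat x). Qed.

Lemma smooth_continuous (h : R -> R) (x : R) : smooth h -> continuous h x.
Proof. intros H. apply @ex_derive_continuous, smooth_ex_derive, H. Qed.

Lemma compact_bounded (f : R -> R) (lo hi : R) :
  (forall x, continuous f x) -> exists M, 0 < M /\ forall x, lo <= x <= hi -> Rabs (f x) <= M.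
Proof.
  intros Hf. destruct (Rle_or_lt lo hi) as [Hle|Hlt].
  - destruct (continuity_ab_maj (fun x => Rabs (f x)) lo hi Hle) as (mx & Hmx & _).
    + intros c _. apply continuity_pt_filterlim.
      apply (continuous_comp f Rabs); [apply Hf | apply continuous_Rabs_id].
    + exists (Rabs (f mx) + 1). split; [generalize (Rabs_pos (f mx)); lra|].
      intros x Hx. generalize (Hmx x Hx). lra.
  - exists 1. split; [lra|]. intros; lra.
Qed.

Lemma smooth_lipschitz (h : R -> R) (lo hi : R) :
  smooth h -> exists K, 0 < K /\ lipschitz_on (fun x => lo <= x <= hi) K h.
Proof.
  intros Hs.
  destruct (compact_bounded (Derive h) lo hi) as (M & HM0 & HM).
  { intros x. apply @ex_derive_continuous. exact (Hs 2%nat x). }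
  exists M. split; [exact HM0|].
  assert (H : forall y z, lo <= y <= hi -> lo <= z <= hi -> y <= z ->
    Rabs (h z - h y) <= M * (z - y)).
  { intros y z Hy Hz Hyz. apply (mvt_bound h (Derive h)); try lra.
    - intros; apply smooth_continuous, Hs.
    - intros x Hx. split; [apply Derive_correct, smooth_ex_derive, Hs|]. apply HM; lra. }
  intros y z Hy Hz. destruct (Rle_or_lt y z).
  - rewrite Rabs_minus_sym, (Rabs_left1 (y - z)) by lra.
    replace (- (y - z)) with (z - y) by ring. auto.
  - rewrite (Rabs_pos_eq (y - z)) by lra. apply H; auto; lra.
Qed.

(** Supplies the constants that belong to the average system. One number serves as Lipschitz
    constant and as bound for both averages. *)
Lemma averages_locally_bounded (h : R -> R) (delta lo hi : R) :
  smooth h -> 0 < delta ->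
  exists K, 0 < K /\
    lipschitz_on (fun x => lo <= x <= hi) K (avg_a h delta) /\
    lipschitz_on (fun x => lo <= x <= hi) K (avg_v h delta) /\
    forall x, lo <= x <= hi -> Rabs (avg_a h delta x) <= K /\ Rabs (avg_v h delta x) <= K.
Proof.
  intros Hs Hd.
  destruct (smooth_lipschitz h (lo - delta) (hi + delta) Hs) as (K & HK0 & HK).
  destruct (compact_bounded h (lo - delta) (hi + delta)) as (M & HM0 & HM).
  { intros; apply smooth_continuous, Hs. }
  assert (Hc : forall x, continuous h x) by (intros; apply smooth_continuous, Hs).
  assert (Hin0 : forall x s, lo <= x <= hi -> Rabs s <= 1 ->
    lo - delta <= x + delta * s <= hi + delta).
  { intros x s Hx Hs1. apply Rabs_le_between in Hs1. nra. }
  assert (Hin : forall x, lo <= x <= hi -> inside delta (fun x => lo - delta <= x <= hi + delta) x).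
  { intros x Hx s Hs1. apply Hin0; auto. }
  exists (K + M). split; [lra|].
  assert (HKK : lipschitz_on (fun x => lo - delta <= x <= hi + delta) (K + M) h).
  { intros y z Hy Hz. eapply Rle_trans; [apply HK; auto|].
    apply Rmult_le_compat_r; [apply Rabs_pos | lra]. }
  split; [|split].
  - intros y z Hy Hz. eapply avg_a_lipschitz; eauto.
  - intros y z Hy Hz. eapply avg_v_lipschitz; eauto.
  - intros x Hx.
    assert (Hb : forall t, Rabs (h (x + delta * dither t)) <= M).
    { intros t. apply HM, Hin0; auto. apply dither_bound. }
    split.
    + apply Rle_trans with ((1 - 0) * M); [|lra].
      apply abs_RInt_le_const; [lra | | auto].
      apply ex_RInt_cont, continuous_shifted, Hc.
    + apply Rle_trans with ((1 - 0) * M); [|lra].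
      apply abs_RInt_le_const; [lra | |].
      * apply ex_RInt_cont, continuous_shifted_mult, Hc.
      * intros t _. rewrite Rabs_mult, <- (Rmult_1_r M).
        apply Rmult_le_compat; auto using Rabs_pos, dither_bound.
Qed.

(* Injectivity makes [f] monotone, and a decrease by at least [alpha] would
   contradict the lower bound because [alpha] is unbounded. *)
Lemma expansive_increasing (f alpha : R -> R) (lb : R) :
  (forall x, continuous f x) -> class_Kinf alpha ->
  (forall s, 0 <= s -> lb <= f s) ->
  (forall s1 s2, 0 <= s1 -> 0 <= s2 -> Rabs (f s2 - f s1) >= alpha (Rabs (s2 - s1))) ->
  forall s1 s2, 0 <= s1 -> s1 <= s2 -> alpha (s2 - s1) <= f s2 - f s1.
Proof.
  intros Hf [(_ & Ha0 & Hinc) Hlim] Hlb Hexp s1 s2 H1 [H12| ->].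
  2: { rewrite !Rminus_diag, Ha0. lra. }
  assert (E := Hexp s1 s2 H1 ltac:(lra)). rewrite (Rabs_pos_eq (s2 - s1)) in E by lra.
  destruct (Rle_or_lt (f s1) (f s2)) as [Hle|Hlt].
  { rewrite Rabs_pos_eq in E by lra. lra. }
  exfalso.
  assert (Hpos : forall s, 0 < s -> 0 < alpha s) by (intros s Hs; rewrite <- Ha0; apply Hinc; lra).
  apply is_lim_spec in Hlim. destruct (Hlim (f s1 - lb)) as [M HM].
  set (X := Rmax M (s2 - s1) + 1).
  assert (HX1 : M < X) by (unfold X; generalize (Rmax_l M (s2 - s1)); lra).
  assert (HX2 : s2 - s1 < X) by (unfold X; generalize (Rmax_r M (s2 - s1)); lra).
  specialize (HM X HX1).
  assert (E2 := Hexp s1 (s1 + X) H1 ltac:(lra)).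
  replace (s1 + X - s1) with X in E2 by ring. rewrite (Rabs_pos_eq X) in E2 by lra.
  assert (Hb := Hlb (s1 + X) ltac:(lra)).
  assert (HfX : f s1 < f (s1 + X)).
  { apply Rnot_le_lt. intros Hc. rewrite Rabs_left1 in E2 by lra. lra. }
  (* At distance X the function can no longer be below f s1, as it would drop under [lb]. So it
     returns to the value f s1 at some s >= s2 > s1, against expansivity. *)
  destruct (IVT_gen f s2 (s1 + X) (f s1)) as (s & Hs & Hfs).
  - intros x. apply continuity_pt_filterlim, Hf.
  - rewrite Rmin_left, Rmax_right by lra. lra.
  - rewrite Rmin_left, Rmax_right in Hs by lra.
    assert (E3 := Hexp s1 s H1 ltac:(lra)).
    rewrite Hfs, Rminus_diag, Rabs_R0, Rabs_pos_eq in E3 by lra.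
    generalize (Hpos (s - s1) ltac:(lra)). lra.
Qed.

Lemma locally_lipschitz_continuous (f : R -> R) (x : R) :
  locally_lipschitz f -> continuous f x.
Proof.
  intros Hf. destruct (Hf x) as (e & L & He & HL).
  apply continuous_eps. intros eps Heps.
  set (k := Rabs L + 1).
  assert (Hk : 0 < k) by (unfold k; generalize (Rabs_pos L); lra).
  assert (Hm : 0 < Rmin e (eps / k)).
  { apply Rmin_glb_lt; [exact He|]. apply Rdiv_lt_0_compat; lra. }
  exists (mkposreal _ Hm). intros y Hy. change (Rabs (y - x) < Rmin e (eps / k)) in Hy.
  assert (Hy1 : Rabs (y - x) < e) by (eapply Rlt_le_trans; [exact Hy | apply Rmin_l]).
  assert (Hy2 : Rabs (y - x) < eps / k) by (eapply Rlt_le_trans; [exact Hy | apply Rmin_r]).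
  eapply Rle_lt_trans.
  - apply HL; [exact Hy1|]. rewrite Rminus_diag, Rabs_R0. exact He.
  - apply Rle_lt_trans with (k * Rabs (y - x)).
    + apply Rmult_le_compat_r; [apply Rabs_pos|]. unfold k. generalize (Rle_abs L). lra.
    + apply (Rmult_lt_compat_l k) in Hy2; [|exact Hk].
      replace (k * (eps / k)) with eps in Hy2 by (field; lra). exact Hy2.
Qed.

(** A comparison function is constrained on [0, oo) only; precomposing with [Rabs] makes it
    continuous on the whole line, as the integration lemmas require. *)
Lemma class_K_continuous_Rabs (alpha : R -> R) (x : R) :
  class_K alpha -> continuous (fun s => alpha (Rabs s)) x.
Proof.
  intros (Hc & _ & _). unfold continuous_on in Hc.
  apply (filterlim_comp _ _ _ Rabs alpha (locally x)
    (within (fun s => 0 <= s) (locally (Rabs x))) (locally (alpha (Rabs x)))).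
  - intros P HP. unfold within in HP.
    generalize (continuous_Rabs_id x _ HP). unfold filtermap.
    apply filter_imp. intros u Hu. apply Hu, Rabs_pos.
  - apply Hc, Rabs_pos.
Qed.

(* Chebyshev's argument: with [alpha (delta * u0)] a level between [A] and the
   mean of [alpha], the increasing factors [u] and [alpha (delta * u)] are
   positively correlated, which gives the bound [u0 * bbar / 2]. *)
Lemma delta_star_drift (alpha : R -> R) (delta A bbar : R) :
  class_K alpha -> 0 < delta -> 0 <= A -> 0 < bbar -> delta_star alpha delta >= A + bbar ->
  exists c, 0 < c /\ forall h x, (forall x, continuous h x) ->
    (forall s, 0 <= s <= delta -> 2 * alpha s - 2 * A <= h (x + s) - h (x - s)) ->
    c <= avg_v h delta x.
Proof.
  intros Hal Hd HA Hb Hstar.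
  set (al := fun s => alpha (Rabs s)).
  assert (Hcal : forall s, continuous al s) by (intros; apply class_K_continuous_Rabs, Hal).
  destruct Hal as (_ & Ha0 & Hinc).
  assert (Hmono : forall s1 s2, 0 <= s1 -> s1 <= s2 -> alpha s1 <= alpha s2).
  { intros s1 s2 H1 [H2| ->]; [|lra]. apply Rlt_le, Hinc; lra. }
  assert (Hcg : forall c w, continuous (fun w => al (c * w)) w).
  { intros c w. apply (continuous_comp (fun w => c * w) al); [|apply Hcal].
    apply @ex_derive_continuous. auto_derive. trivial. }
  assert (Hcd : forall t, continuous (fun t => al (delta * dither t)) t).
  { intros t. apply (continuous_comp dither (fun w => al (delta * w))); [|apply Hcg].
    apply continuous_dither. }
  assert (Hdu : forall t, 0 <= t <= / 2 -> 0 <= dither t <= 1).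
  { intros t Ht. split; [apply dither_pos, Ht|].
    generalize (dither_bound t), (Rle_abs (dither t)). lra. }
  assert (Hint : RInt (fun t => al (delta * dither t)) 0 (/ 2) >= (A + bbar) / 2).
  { assert (E : delta_star alpha delta = 2 * RInt (fun t => al (delta * dither t)) 0 (/ 2)).
    { unfold delta_star. replace (1 / 2) with (/ 2) by field. f_equal.
      apply RInt_ext. rewrite Rmin_left, Rmax_right by lra. intros t Ht. unfold al.
      rewrite Rabs_pos_eq; [reflexivity|]. generalize (Hdu t ltac:(lra)). nra. }
    lra. }
  set (A' := A + bbar / 2).
  assert (Hal1 : A' < al (delta * 1)).
  { assert (E : RInt (fun t => al (delta * dither t)) 0 (/ 2) <= RInt (fun _ => al (delta * 1)) 0 (/ 2)).
    { apply RInt_le; [lra | apply ex_RInt_cont, Hcd | apply ex_RInt_const |].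
      intros t Ht. generalize (Hdu t ltac:(lra)). intros. unfold al.
      rewrite !Rabs_pos_eq by nra. apply Hmono; nra. }
    rewrite RInt_cst in E. unfold A'. lra. }
  (* The value at full amplitude is at least the mean, hence above A', while the value at 0 is 0:
     the level A' is attained at some amplitude u0. *)
  destruct (IVT_gen (fun w => al (delta * w)) 0 1 A') as (u0 & Hu0 & Hal0).
  - intros w. apply continuity_pt_filterlim, Hcg.
  - assert (E : al (delta * 0) = 0) by (unfold al; rewrite Rmult_0_r, Rabs_R0; exact Ha0).
    rewrite E, Rmin_left, Rmax_right by (unfold A' in *; lra). unfold A' in *; lra.
  - rewrite Rmin_left, Rmax_right in Hu0 by lra.
    assert (Hu0p : 0 < u0).
    { destruct (proj1 Hu0) as [H|H]; [exact H|]. exfalso. subst u0.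
      unfold al in Hal0. rewrite Rmult_0_r, Rabs_R0, Ha0 in Hal0. unfold A' in Hal0. lra. }
    exists (u0 * (bbar / 2)). split; [nra|]. intros h x Hh Hinc2.
    (* Since u(t + 1/2) = - u(t), folding the period gives the integrand (h(x + delta u) - h(x -
       delta u)) u with u >= 0. *)
    unfold avg_v. rewrite RInt_halves by (apply continuous_shifted_mult, Hh).
    apply Rle_trans with (RInt (fun t => 2 * u0 * (al (delta * dither t) - A')) 0 (/ 2)).
    + rewrite RInt_mult_l by (apply ex_RInt_sub; [apply ex_RInt_cont, Hcd | apply ex_RInt_const]).
      rewrite RInt_sub by (apply ex_RInt_cont, Hcd || apply ex_RInt_const).
      rewrite RInt_cst. unfold A'.
      replace (u0 * (bbar / 2)) with (2 * u0 * (bbar / 4)) by field.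
      apply Rmult_le_compat_l; lra.
    + apply RInt_le; [lra | | |].
      * apply ex_RInt_mult_l, ex_RInt_sub; [apply ex_RInt_cont, Hcd | apply ex_RInt_const].
      * apply ex_RInt_cont. intros t.
        apply (continuous_plus (fun t => h (x + delta * dither t) * dither t)).
        -- apply continuous_shifted_mult, Hh.
        -- apply (continuous_comp (fun t => t + / 2) (fun t => h (x + delta * dither t) * dither t)).
           ++ apply (continuous_plus (fun t => t) (fun _ => / 2));
                [apply continuous_id | apply continuous_const].
           ++ apply continuous_shifted_mult, Hh.
      * intros t Ht. destruct (Hdu t ltac:(lra)) as [Hu1 Hu2].
        rewrite dither_half. set (u := dither t) in *.
        assert (Hdu2 : 0 <= delta * u <= delta) by nra.
        generalize (Hinc2 (delta * u) Hdu2).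
        replace (x + delta * - u) with (x - delta * u) by ring. intros H1.
        assert (Hal2 : al (delta * u) = alpha (delta * u))
          by (unfold al; rewrite Rabs_pos_eq; [reflexivity | lra]).
        assert (Hal3 : alpha (delta * u0) = A').
        { rewrite <- Hal0. unfold al. rewrite Rabs_pos_eq; [reflexivity | nra]. }
        assert (H2 : 0 <= (alpha (delta * u) - A') * (u - u0)).
        { rewrite <- Hal3. destruct (Rle_or_lt u u0) as [Hle|Hlt].
          - assert (alpha (delta * u) <= alpha (delta * u0)) by (apply Hmono; nra). nra.
          - assert (alpha (delta * u0) <= alpha (delta * u)) by (apply Hmono; nra). nra. }
        rewrite Hal2. unfold A' in *. nra.
Qed.

Lemma avg_v_opp (h : R -> R) (delta x : R) : (forall x, continuous h x) ->
  avg_v (fun x => - h x) delta x = - avg_v h delta x.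
Proof.
  intros Hh. unfold avg_v.
  rewrite (RInt_ext _ (fun t => -1 * (h (x + delta * dither t) * dither t))).
  - rewrite RInt_mult_l by (apply ex_RInt_cont, continuous_shifted_mult, Hh).
    lra.
  - intros t _. cbn. lra.
Qed.

(** At distance at least delta from xs the window [x - delta, x + delta] lies on one side of xs,
    where m grows outwards at least like alpha. Passing from x - s to x + s through x, m changes by
    at least 2 alpha(s) and h by at least 2 alpha(s) - 2 A, as [delta_star_drift] asks. The left
    side follows by applying it to - h. *)
Lemma far_drift (h m alpha : R -> R) (xs A delta bbar : R) :
  assumption1 h xs -> assumption2 h xs m alpha A ->
  0 < delta -> 0 < bbar -> delta_star alpha delta >= A + bbar ->
  exists c, 0 < c /\
    (forall x, xs + delta <= x -> c <= avg_v h delta x) /\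
    (forall x, x <= xs - delta -> avg_v h delta x <= - c).
Proof.
  intros [Hs Hmin] (Hml & _ & Hal & HA & Hmh & Hexp) Hd Hb Hstar.
  destruct (delta_star_drift alpha delta A bbar (proj1 Hal) Hd HA Hb Hstar) as (c & Hc & Hdr).
  assert (Hh : forall x, continuous h x) by (intros; apply smooth_continuous, Hs).
  assert (Hm : forall x, continuous m x) by (intros; apply locally_lipschitz_continuous, Hml).
  (* The minimum of h bounds m from below; this is what excludes that m decreases away from xs. *)
  assert (Hlb : forall x, h xs - A <= m x).
  { intros x. generalize (Hmh x). destruct (Req_dec x xs) as [->|Hne]; [lra|].
    generalize (Hmin x Hne). lra. }
  assert (HR : forall s1 s2, 0 <= s1 -> s1 <= s2 -> alpha (s2 - s1) <= m (xs + s2) - m (xs + s1)).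
  { apply (expansive_increasing (fun s => m (xs + s)) alpha (h xs - A)); auto.
    - intros s. apply (continuous_comp (fun s => xs + s) m); [|apply Hm].
      apply (continuous_plus (fun _ => xs) (fun s => s));
        [apply continuous_const | apply continuous_id].
    - intros s1 s2 H1 H2. replace (s2 - s1) with ((xs + s2) - (xs + s1)) by ring.
      apply Hexp. replace (_ * _) with (s1 * s2) by ring. nra. }
  assert (HLft : forall s1 s2, 0 <= s1 -> s1 <= s2 -> alpha (s2 - s1) <= m (xs - s2) - m (xs - s1)).
  { apply (expansive_increasing (fun s => m (xs - s)) alpha (h xs - A)); auto.
    - intros s. apply (continuous_comp (fun s => xs - s) m); [|apply Hm].
      apply (continuous_minus (fun _ => xs) (fun s => s));
        [apply continuous_const | apply continuous_id].
    - intros s1 s2 H1 H2.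
      replace (Rabs (s2 - s1)) with (Rabs ((xs - s2) - (xs - s1)))
        by (rewrite <- Rabs_Ropp; f_equal; ring).
      apply Hexp. replace (_ * _) with (s1 * s2) by ring. nra. }
  exists c. split; [exact Hc|]. split; intros x Hx.
  - apply Hdr; auto. intros s Hs2.
    generalize (HR (x - s - xs) (x - xs) ltac:(lra) ltac:(lra)),
      (HR (x - xs) (x + s - xs) ltac:(lra) ltac:(lra)), (Hmh (x + s)), (Hmh (x - s)).
    replace (x - xs - (x - s - xs)) with s by ring.
    replace (x + s - xs - (x - xs)) with s by ring.
    replace (xs + (x - s - xs)) with (x - s) by ring.
    replace (xs + (x - xs)) with x by ring.
    replace (xs + (x + s - xs)) with (x + s) by ring. lra.
  - assert (E : c <= avg_v (fun x => - h x) delta x).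
    { apply Hdr.
      - intros y. apply (continuous_opp h), Hh.
      - intros s Hs2.
        generalize (HLft (xs - x - s) (xs - x) ltac:(lra) ltac:(lra)),
          (HLft (xs - x) (xs - x + s) ltac:(lra) ltac:(lra)), (Hmh (x + s)), (Hmh (x - s)).
        replace (xs - x - (xs - x - s)) with s by ring.
        replace (xs - x + s - (xs - x)) with s by ring.
        replace (xs - (xs - x - s)) with (x + s) by ring.
        replace (xs - (xs - x)) with x by ring.
        replace (xs - (xs - x + s)) with (x - s) by ring. lra. }
    rewrite avg_v_opp in E by exact Hh. lra.
Qed.

(** * Distances, solutions and attractors *)

Section Distance.

Context {V : NormedModule R_AbsRing}.
Variable S : V -> Prop.
Hypothesis HS : exists q, S q.

(** A point of S bounds the infimum above and nonnegativity of norms bounds it below, so it is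
    finite and [real] loses nothing. *)
Lemma dist_to_is_glb (z : V) :
  is_glb_Rbar (fun s => exists q, S q /\ s = norm (minus z q)) (dist_to S z).
Proof.
  unfold dist_to. set (E := fun s : R => exists q, S q /\ s = norm (minus z q)).
  generalize (Glb_Rbar_correct E). intros [H1 H2].
  assert (H0 : Rbar_le 0 (Glb_Rbar E)).
  { apply H2. intros s (q & _ & ->). apply norm_ge_0. }
  destruct HS as [q Hq].
  assert (H3 := H1 _ (ex_intro _ q (conj Hq eq_refl))).
  destruct (Glb_Rbar E); simpl in *; try contradiction. split; assumption.
Qed.

Lemma dist_to_le (z q : V) : S q -> dist_to S z <= norm (minus z q).
Proof.
  intros Hq. apply (proj1 (dist_to_is_glb z) (norm (minus z q))). exists q; auto.
Qed.

Lemma dist_to_ge (z : V) (c : R) :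
  (forall q, S q -> c <= norm (minus z q)) -> c <= dist_to S z.
Proof.
  intros H. apply (proj2 (dist_to_is_glb z) (Finite c)). intros s (q & Hq & ->).
  apply H, Hq.
Qed.

Lemma dist_to_pos (z : V) : 0 <= dist_to S z.
Proof. apply dist_to_ge. intros; apply norm_ge_0. Qed.

Lemma dist_to_triangle (z w : V) : dist_to S z <= dist_to S w + norm (minus z w).
Proof.
  assert (H : dist_to S z - norm (minus z w) <= dist_to S w); [|lra].
  apply dist_to_ge. intros q Hq.
  assert (H : norm (minus z q) <= norm (minus z w) + norm (minus w q)).
  { eapply Rle_trans; [|apply norm_triangle]. apply Req_le, f_equal. exact (minus_trans (G := V) w z q). }
  generalize (dist_to_le z q Hq). lra.
Qed.

End Distance.

Lemma norm_pair_le (x y : R) : norm (x, y) <= Rabs x + Rabs y.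
Proof.
  change (sqrt (Rabs x ^ 2 + Rabs y ^ 2) <= Rabs x + Rabs y).
  generalize (Rabs_pos x), (Rabs_pos y). intros Hx Hy.
  rewrite <- (sqrt_pow2 (Rabs x + Rabs y)) by lra.
  apply sqrt_le_1_alt. nra.
Qed.

Lemma is_derive_pair (x y : R -> R) (t lx ly : R) :
  is_derive x t lx -> is_derive y t ly ->
  is_derive (V := prod_NormedModule _ R_NormedModule R_NormedModule)
    (fun t => (x t, y t)) t (lx, ly).
Proof.
  intros Hx Hy.
  apply (filterdiff_ext_lin _ (fun s : R => (scal s lx, scal s ly))).
  - apply (filterdiff_comp'_2 x y (fun a b => (a, b)) t (fun s => scal s lx)
      (fun s => scal s ly) (fun a b => (a, b))); [exact Hx | exact Hy |].
    apply (filterdiff_ext (fun p => p)); [intros [a b]; reflexivity|].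
    apply (filterdiff_ext_lin _ (fun p => p)); [|intros [a b]; reflexivity].
    apply filterdiff_id.
  - reflexivity.
Qed.

Lemma is_derive_fst (z : R -> R * R) (t : R) (l : R * R) :
  is_derive z t l -> is_derive (fun t => fst (z t)) t (fst l).
Proof.
  intros Hz. apply (filterdiff_ext_lin _ (fun s : R => fst (scal s l))); [|reflexivity].
  apply (filterdiff_comp' z fst t _ (fst : R * R -> R) Hz).
  apply filterdiff_linear, is_linear_fst.
Qed.

Lemma is_derive_snd (z : R -> R * R) (t : R) (l : R * R) :
  is_derive z t l -> is_derive (fun t => snd (z t)) t (snd l).
Proof.
  intros Hz. apply (filterdiff_ext_lin _ (fun s : R => snd (scal s l))); [|reflexivity].
  apply (filterdiff_comp' z snd t _ (snd : R * R -> R) Hz).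
  apply filterdiff_linear, is_linear_snd.
Qed.

(** Solutions are constrained for t >= 0 only. Extending them by their initial value to the left
    gives two-sided continuity at 0, so the results on closed intervals apply from time 0 on. *)
Lemma right_extension_continuous (f : R -> R) :
  filterlim f (at_right 0) (locally (f 0)) -> continuous (fun t => f (Rmax 0 t)) 0.
Proof.
  intros H. apply continuous_eps. intros eps He. rewrite Rmax_left by lra.
  destruct (proj1 (filterlim_locally f (f 0)) H (mkposreal eps He)) as [d Hd].
  exists d. intros t Ht. destruct (Rle_or_lt t 0) as [Hle|Hlt].
  - rewrite Rmax_left, Rminus_diag, Rabs_R0 by lra. exact He.
  - rewrite Rmax_right by lra. apply (Hd t Ht Hlt).
Qed.

Lemma right_extension_derive (f : R -> R) (t l : R) : 0 < t ->
  is_derive f t l -> is_derive (fun t => f (Rmax 0 t)) t l.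
Proof.
  intros Ht. apply is_derive_ext_loc. exists (mkposreal t Ht). intros s Hs.
  change (Rabs (s - t) < t) in Hs. apply Rabs_def2 in Hs. rewrite Rmax_right by lra.
  reflexivity.
Qed.

Lemma is_solution_components (F : R -> R * R -> R * R) (T : Rbar) (z : R -> R * R) :
  is_solution F T z ->
  let x := fun t => fst (z (Rmax 0 t)) in
  let y := fun t => snd (z (Rmax 0 t)) in
  (forall t, 0 <= t -> Rbar_lt t T -> continuous x t /\ continuous y t) /\
  (forall t, 0 < t -> Rbar_lt t T ->
     is_derive x t (fst (F t (x t, y t))) /\ is_derive y t (snd (F t (x t, y t)))).
Proof.
  intros (_ & H0 & Hd) x y.
  assert (D : forall t, 0 < t -> Rbar_lt t T ->
     is_derive x t (fst (F t (x t, y t))) /\ is_derive y t (snd (F t (x t, y t)))).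
  { intros t Ht HtT. specialize (Hd t Ht HtT). unfold x, y.
    rewrite (Rmax_right 0 t) by lra. rewrite <- surjective_pairing. split.
    - apply (right_extension_derive (fun t => fst (z t))); [exact Ht|].
      apply is_derive_fst, Hd.
    - apply (right_extension_derive (fun t => snd (z t))); [exact Ht|].
      apply is_derive_snd, Hd. }
  split; [|exact D].
  intros t [Ht|<-] HtT.
  - destruct (D t Ht HtT) as [D1 D2].
    split; apply @ex_derive_continuous; eexists; eassumption.
  - split.
    + apply (right_extension_continuous (fun t => fst (z t))).
      eapply filterlim_comp; [exact H0|]. apply continuous_fst.
    + apply (right_extension_continuous (fun t => snd (z t))).
      eapply filterlim_comp; [exact H0|]. apply continuous_snd.
Qed.

Lemma is_solution_pair (F : R -> R * R -> R * R) (x y : R -> R) :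
  (forall t, 0 <= t -> is_derive x t (fst (F t (x t, y t))) /\
                       is_derive y t (snd (F t (x t, y t)))) ->
  is_solution F p_infty (fun t => (x t, y t)).
Proof.
  intros H.
  assert (D : forall t, 0 <= t -> is_derive (V := prod_NormedModule _ R_NormedModule R_NormedModule)
    (fun t => (x t, y t)) t (F t (x t, y t))).
  { intros t Ht. destruct (H t Ht) as [H1 H2].
    rewrite (surjective_pairing (F t (x t, y t))). apply is_derive_pair; assumption. }
  split; [exact I|]. split.
  - eapply filterlim_filter_le_1; [apply filter_le_within|].
    apply (@ex_derive_continuous _ (prod_NormedModule _ R_NormedModule R_NormedModule)
      (fun t => (x t, y t)) 0).
    eexists. apply D. lra.
  - intros t Ht _. apply D. lra.
Qed.

Definition clamp (lo hi x : R) : R := Rmax lo (Rmin x hi).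

Lemma clamp_in lo hi x : lo <= hi -> lo <= clamp lo hi x <= hi.
Proof.
  intros H. unfold clamp. split; [apply Rmax_l|]. apply Rmax_lub; [exact H | apply Rmin_r].
Qed.

Lemma clamp_id lo hi x : lo <= x <= hi -> clamp lo hi x = x.
Proof. intros H. unfold clamp. rewrite Rmin_left, Rmax_right; lra. Qed.

Lemma clamp_lipschitz lo hi x y : Rabs (clamp lo hi x - clamp lo hi y) <= Rabs (x - y).
Proof.
  unfold clamp, Rmax, Rmin.
  destruct (Rle_dec x hi), (Rle_dec y hi); repeat destruct (Rle_dec _ _);
    unfold Rabs; repeat destruct (Rcase_abs _); lra.
Qed.

Lemma lipschitz_clamp (f : R -> R) (lo hi L x y : R) :
  lo <= hi -> 0 <= L -> lipschitz_on (fun x => lo <= x <= hi) L f ->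
  Rabs (f (clamp lo hi x) - f (clamp lo hi y)) <= L * Rabs (x - y).
Proof.
  intros Hlh HL Hf. eapply Rle_trans; [apply Hf; apply clamp_in, Hlh|].
  apply Rmult_le_compat_l; [exact HL | apply clamp_lipschitz].
Qed.

(** The field is frozen outside [lo, hi] to make it globally Lipschitz. The signs of v at the
    endpoints make [lo, hi] invariant, and |a| <= Y makes [-Y, Y] invariant for y; inside, truncated
    and true field coincide. *)
Lemma average_solution (a v : R -> R) (lo hi K Y x0 y0 : R) :
  lo <= hi -> 0 < K ->
  lipschitz_on (fun x => lo <= x <= hi) K a ->
  lipschitz_on (fun x => lo <= x <= hi) K v ->
  0 <= v hi -> v lo <= 0 ->
  (forall x, lo <= x <= hi -> Rabs (a x) <= Y) ->
  lo <= x0 <= hi -> Rabs y0 <= Y ->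
  exists x y : R -> R, x 0 = x0 /\ y 0 = y0 /\ forall t, 0 <= t ->
    is_derive x t (- v (x t)) /\ is_derive y t (a (x t) - y t) /\
    lo <= x t <= hi /\ Rabs (y t) <= Y.
Proof.
  intros Hlh HK Hla Hlv Hvhi Hvlo HaY Hx0 Hy0.
  set (F := fun (i : bool) (_ x y : R) =>
    if i then - v (clamp lo hi x) else a (clamp lo hi x) - y).
  destruct (picard_exists F (K + 1) (Rabs (v (clamp lo hi x0)) + Rabs (a (clamp lo hi x0) - y0))
     (fun i => if i then x0 else y0)) as (z & Hz0 & Hz).
  - lra.
  - intros i s x y x' y'.
    generalize (lipschitz_clamp v lo hi K x x' Hlh (Rlt_le _ _ HK) Hlv),
      (lipschitz_clamp a lo hi K x x' Hlh (Rlt_le _ _ HK) Hla), (Rabs_pos (x - x')),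
      (Rabs_pos (y - y')).
    intros H1 H2 H3 H4. destruct i; unfold F.
    + replace (_ - _) with (- (v (clamp lo hi x) - v (clamp lo hi x'))) by ring.
      rewrite Rabs_Ropp. nra.
    + replace (_ - _) with ((a (clamp lo hi x) - a (clamp lo hi x')) + - (y - y')) by ring.
      eapply Rle_trans; [apply Rabs_triang|]. rewrite Rabs_Ropp. nra.
  - intros i x y s. apply continuous_const.
  - intros i s. generalize (Rabs_pos (v (clamp lo hi x0))), (Rabs_pos (a (clamp lo hi x0) - y0)).
    destruct i; unfold F; [rewrite Rabs_Ropp|]; lra.
  - set (x := z true). set (y := z false).
    assert (Dx : forall t, 0 <= t -> is_derive x t (- v (clamp lo hi (x t))))
      by (intros t Ht; exact (Hz true t Ht)).
    assert (Dy : forall t, 0 <= t -> is_derive y t (a (clamp lo hi (x t)) - y t))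
      by (intros t Ht; exact (Hz false t Ht)).
    assert (Cx : forall t, 0 <= t -> continuous x t)
      by (intros; apply @ex_derive_continuous; eexists; auto).
    assert (Cy : forall t, 0 <= t -> continuous y t)
      by (intros; apply @ex_derive_continuous; eexists; auto).
    assert (X0 : x 0 = x0) by apply (Hz0 true).
    assert (Y0 : y 0 = y0) by apply (Hz0 false).
    apply Rabs_le_between in Hy0.
    assert (Inv : forall t, 0 <= t -> lo <= x t <= hi /\ Rabs (y t) <= Y).
    { intros t Ht.
      assert (HaYc : forall s, Rabs (a (clamp lo hi (x s))) <= Y)
        by (intros; apply HaY, clamp_in, Hlh).
      assert (E1 : x t <= hi).
      { apply (barrier x (fun s => - v (clamp lo hi (x s))) t hi Ht).
        - intros; apply Cx; lra.
        - intros; apply Dx; lra.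
        - intros s _ Hs. unfold clamp. rewrite Rmin_right, Rmax_right by lra. lra.
        - lra. }
      assert (E2 : - x t <= - lo).
      { apply (barrier (fun s => - x s) (fun s => - - v (clamp lo hi (x s))) t (- lo) Ht).
        - intros; apply (continuous_opp x), Cx; lra.
        - intros; apply (is_derive_opp x), Dx; lra.
        - intros s _ Hs. unfold clamp. rewrite Rmin_left, Rmax_left by lra. lra.
        - lra. }
      assert (E3 : y t <= Y).
      { apply (barrier y (fun s => a (clamp lo hi (x s)) - y s) t Y Ht).
        - intros; apply Cy; lra.
        - intros; apply Dy; lra.
        - intros s _ Hs. generalize (HaYc s), (Rle_abs (a (clamp lo hi (x s)))). lra.
        - lra. }
      assert (E4 : - y t <= Y).
      { apply (barrier (fun s => - y s) (fun s => - (a (clamp lo hi (x s)) - y s)) t Y Ht).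
        - intros; apply (continuous_opp y), Cy; lra.
        - intros; apply (is_derive_opp y), Dy; lra.
        - intros s _ Hs. generalize (HaYc s). intros HH; apply Rabs_le_between in HH. lra.
        - lra. }
      split; [lra|]. apply Rabs_le. lra. }
    exists x, y. split; [exact X0|]. split; [exact Y0|]. intros t Ht.
    destruct (Inv t Ht) as [I1 I2]. generalize (Dx t Ht), (Dy t Ht).
    rewrite clamp_id by exact I1. auto.
Qed.

(** Without zeros beyond q and positive far out, v is positive on (q, oo) by the intermediate value
    theorem. A compact minimum and the far bound c0 then give a uniform constant. *)
Lemma positive_margin (v : R -> R) (q c0 X0 : R) :
  (forall x, continuous v x) -> 0 < c0 -> (forall x, X0 <= x -> c0 <= v x) ->
  (forall x, q < x -> v x <> 0) ->
  forall eta, 0 < eta -> exists c, 0 < c /\ forall x, q + eta <= x -> c <= v x.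
Proof.
  intros Hv Hc0 Hfar Hnz.
  assert (Hpos : forall x, q < x -> 0 < v x).
  { intros x Hx. apply Rnot_le_lt. intros Hle.
    set (X := Rmax x X0).
    assert (x <= X) by apply Rmax_l.
    assert (HX : c0 <= v X) by (apply Hfar, Rmax_r).
    destruct (IVT_gen v x X 0) as (y & Hy & Hy0).
    - intros u. apply continuity_pt_filterlim, Hv.
    - rewrite Rmin_left, Rmax_right by lra. lra.
    - rewrite Rmin_left, Rmax_right in Hy by lra. apply (Hnz y); [lra | exact Hy0]. }
  intros eta He.
  set (M := Rmax (q + eta) X0).
  destruct (continuity_ab_min v (q + eta) M) as (mn & Hmn & Hmni).
  - apply Rmax_l.
  - intros; apply continuity_pt_filterlim, Hv.
  - exists (Rmin (v mn) c0). split.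
    + apply Rmin_glb_lt; [apply Hpos; lra | exact Hc0].
    + intros x Hx. destruct (Rle_or_lt x M) as [HxM|HxM].
      * eapply Rle_trans; [apply Rmin_l|]. apply Hmn; lra.
      * eapply Rle_trans; [apply Rmin_r|]. apply Hfar.
        eapply Rle_trans; [apply Rmax_r | apply Rlt_le, HxM].
Qed.

(** A zero of b1 is a constant solution; its distance to S is bounded by a function tending to 0. *)
Lemma equilibrium_in_attractor (b1 : R -> R) (S : R -> Prop) (x : R) :
  (exists a, S a) -> globally_asymptotically_stable (avg_x_field b1 1) S ->
  b1 x = 0 -> dist_to S x <= 0.
Proof.
  intros HS (beta & (_ & Hbeta) & H) Hx.
  assert (Hsol : is_solution (avg_x_field b1 1) p_infty (fun _ => x)).
  { split; [exact I|]. split; [apply filterlim_const|].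
    intros t _ _. unfold avg_x_field. rewrite Hx.
    replace (- (1) * (0 / 2)) with (zero : R) by (unfold zero; simpl; field).
    apply @is_derive_const. }
  specialize (H _ _ Hsol).
  destruct (Hbeta _ (dist_to_pos S HS x)) as [_ Hlim].
  change (Rbar_le (dist_to S x) 0).
  apply (is_lim_le_loc (fun _ => dist_to S x) (beta (dist_to S x)) p_infty).
  - exists 0. intros t Ht. apply H; [lra | exact I].
  - apply is_lim_const.
  - exact Hlim.
Qed.

(** * Slow evolution of the trajectories *)

(* The increment of [a] is estimated with both constants: [K] weighs the
   leading term and [L] the remainder, so that the smallness required of
   [gamma] involves [L] only. *)
Lemma output_error_step (gamma L K V C x x' y y' a a' v : R) :
  0 < gamma <= 1 -> 0 <= L -> 0 <= K -> 0 <= V -> 0 <= C ->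
  gamma * ((L + 1) * C) <= 1 ->
  Rabs (x' - x + gamma * v) <= C * gamma ^ 2 ->
  Rabs (y' - y - gamma * (a - y)) <= C * gamma ^ 2 ->
  Rabs (a' - a) <= L * Rabs (x' - x) -> Rabs (a' - a) <= K * Rabs (x' - x) ->
  Rabs v <= V ->
  Rabs (y' - a') <= (1 - gamma) * Rabs (y - a) + gamma * (K * V + 1).
Proof.
  intros Hg HL HK HV HC HgC Hx Hy HaL HaK Hv.
  assert (Hdx : Rabs (x' - x) <= gamma * V + C * gamma ^ 2).
  { replace (x' - x) with ((x' - x + gamma * v) + - (gamma * v)) by ring.
    eapply Rle_trans; [apply Rabs_triang|].
    rewrite Rabs_Ropp, Rabs_mult, (Rabs_pos_eq gamma) by lra.
    assert (gamma * Rabs v <= gamma * V) by (apply Rmult_le_compat_l; lra). lra. }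
  assert (Hg2 : 0 <= C * gamma ^ 2) by (apply Rmult_le_pos; [exact HC | apply pow2_ge_0]).
  assert (HgV : 0 <= gamma * V) by (apply Rmult_le_pos; lra).
  assert (Hda : Rabs (a' - a) <= K * (gamma * V) + L * (C * gamma ^ 2)).
  { destruct (Rle_or_lt K L).
    - eapply Rle_trans; [exact HaK|].
      apply Rle_trans with (K * (gamma * V + C * gamma ^ 2)); [apply Rmult_le_compat_l; lra|].
      assert (K * (C * gamma ^ 2) <= L * (C * gamma ^ 2)) by (apply Rmult_le_compat_r; lra). lra.
    - eapply Rle_trans; [exact HaL|].
      apply Rle_trans with (L * (gamma * V + C * gamma ^ 2)); [apply Rmult_le_compat_l; lra|].
      assert (L * (gamma * V) <= K * (gamma * V)) by (apply Rmult_le_compat_r; lra). lra. }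
  replace (y' - a') with
    ((1 - gamma) * (y - a) + ((y' - y - gamma * (a - y)) + - (a' - a))) by ring.
  eapply Rle_trans; [apply Rabs_triang|].
  eapply Rle_trans; [apply Rplus_le_compat_l, Rabs_triang|].
  rewrite Rabs_mult, (Rabs_pos_eq (1 - gamma)), Rabs_Ropp by lra.
  assert (gamma * (gamma * ((L + 1) * C)) <= gamma * 1) by (apply Rmult_le_compat_l; lra).
  replace (gamma * (gamma * ((L + 1) * C))) with (L * (C * gamma ^ 2) + C * gamma ^ 2) in H by ring.
  lra.
Qed.

(** Beyond q + eta the descent gamma c beats the error C gamma^2 <= gamma c / 2, so at least gamma c
    / 2 is gained. From below q + eta, a step of length at most eta cannot pass q + 2 eta. Applied
    to x, and to - x with - p and - v. *)
Lemma drift_step (gamma C c eta q x x' v B : R) (n : nat) :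
  0 < gamma -> gamma * C <= c / 2 -> Rabs (x' - x) <= eta ->
  Rabs (x' - x + gamma * v) <= C * gamma ^ 2 ->
  (q + eta <= x -> c <= v) ->
  x <= Rmax (B - gamma * INR n * (c / 2)) (q + 2 * eta) ->
  x' <= Rmax (B - gamma * INR (S n) * (c / 2)) (q + 2 * eta).
Proof.
  intros Hg HgC Hxx Hx Hv HB.
  apply Rabs_le_between in Hxx. apply Rabs_le_between in Hx.
  destruct (Rle_or_lt (q + eta) x) as [Hle|Hlt].
  - specialize (Hv Hle).
    assert (H1 : x' <= x - gamma * (c / 2)) by nra.
    assert (Hc : 0 <= gamma * (c / 2) \/ gamma * (c / 2) < 0) by lra.
    rewrite S_INR. revert HB. unfold Rmax. repeat destruct (Rle_dec _ _); intros; nra.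
  - eapply Rle_trans; [|apply Rmax_r]. lra.
Qed.

(** Bernoulli's inequality in the form (1 - gamma)^k (1 + gamma k) <= 1: an error B falls to 1
    within slow time B, uniformly in gamma. *)
Lemma pow_decay (gamma B : R) (k : nat) :
  0 < gamma <= 1 -> 0 <= B <= gamma * INR k -> (1 - gamma) ^ k * B <= 1.
Proof.
  intros Hg HB.
  assert (H : (1 - gamma) ^ k * (1 + gamma * INR k) <= 1).
  { clear HB. induction k as [|k IH].
    - simpl. lra.
    - assert (H0 : 0 <= (1 - gamma) ^ k) by (apply pow_le; lra).
      rewrite S_INR. simpl ((1 - gamma) ^ S k).
      assert (Hk := pos_INR k).
      apply Rle_trans with ((1 - gamma) ^ k * (1 + gamma * INR k)); [|exact IH].
      rewrite (Rmult_comm (1 - gamma)), Rmult_assoc. apply Rmult_le_compat_l; [exact H0|].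
      assert (0 <= gamma * gamma * INR k) by (apply Rmult_le_pos; nra). nra. }
  assert (H0 : 0 <= (1 - gamma) ^ k) by (apply pow_le; lra).
  apply Rle_trans with ((1 - gamma) ^ k * (1 + gamma * INR k)); [|exact H].
  apply Rmult_le_compat_l; lra.
Qed.

Lemma discrete_gronwall (S : nat -> R) (kappa w : R) (N : nat) :
  0 <= kappa -> 0 <= w -> S O = 0 ->
  (forall k, (k < N)%nat -> S (k + 1)%nat <= (1 + kappa) * S k + w) ->
  S N <= w * INR N * exp (kappa * INR N).
Proof.
  intros Hk Hw H0 Hs.
  assert (H : forall k, (k <= N)%nat -> S k <= w * INR k * (1 + kappa) ^ k).
  { induction k as [|k IH]; intros HkN.
    - rewrite H0. simpl. lra.
    - replace (Datatypes.S k) with (k + 1)%nat by lia.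
      eapply Rle_trans; [apply Hs; lia|].
      replace (k + 1)%nat with (Datatypes.S k) by lia.
      rewrite S_INR. simpl ((1 + kappa) ^ Datatypes.S k).
      specialize (IH ltac:(lia)).
      assert (H1 : 1 <= (1 + kappa) * (1 + kappa) ^ k).
      { change (1 <= (1 + kappa) ^ Datatypes.S k). apply pow_R1_Rle. lra. }
      assert ((1 + kappa) * S k <= (1 + kappa) * (w * INR k * (1 + kappa) ^ k))
        by (apply Rmult_le_compat_l; lra).
      assert (w * 1 <= w * ((1 + kappa) * (1 + kappa) ^ k)) by (apply Rmult_le_compat_l; lra).
      lra. }
  eapply Rle_trans; [apply H; lia|].
  apply Rmult_le_compat_l; [apply Rmult_le_pos; [exact Hw | apply pos_INR]|].
  clear - Hk. induction N as [|N IH].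
  - simpl. rewrite Rmult_0_r, exp_0. lra.
  - rewrite S_INR. simpl ((1 + kappa) ^ Datatypes.S N).
    replace (kappa * (INR N + 1)) with (kappa + kappa * INR N) by ring. rewrite exp_plus.
    apply Rmult_le_compat; [lra | apply pow_le; lra | apply exp_ineq1_le | exact IH].
Qed.

(** Sampled at multiples of gamma, the average solution obeys the Euler recursion that the
    trajectory obeys at whole periods. The speeds are at most K and K + Y <= 2 Y, and the field is
    K-Lipschitz in x and 1-Lipschitz in y, whence K K + 2 Y. *)
Lemma average_step (a v : R -> R) (lo hi K Y gamma : R) (xa ya : R -> R) (s : R) :
  0 < K -> K <= Y -> 0 < gamma -> 0 <= s ->
  lipschitz_on (fun z => lo <= z <= hi) K a -> lipschitz_on (fun z => lo <= z <= hi) K v ->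
  (forall z, lo <= z <= hi -> Rabs (a z) <= K /\ Rabs (v z) <= K) ->
  (forall t, 0 <= t -> is_derive xa t (- v (xa t)) /\ is_derive ya t (a (xa t) - ya t) /\
     lo <= xa t <= hi /\ Rabs (ya t) <= Y) ->
  Rabs (xa (s + gamma) - xa s + gamma * v (xa s)) <= (K * K + 2 * Y) * gamma ^ 2 /\
  Rabs (ya (s + gamma) - ya s - gamma * (a (xa s) - ya s)) <= (K * K + 2 * Y) * gamma ^ 2.
Proof.
  intros HK HKY Hg Hs Hla Hlv Hb Hsol.
  assert (Cx : forall t, 0 <= t -> continuous xa t)
    by (intros t Ht; destruct (Hsol t Ht) as (D & _); apply @ex_derive_continuous;
        eexists; exact D).
  assert (Cy : forall t, 0 <= t -> continuous ya t)
    by (intros t Ht; destruct (Hsol t Ht) as (_ & D & _); apply @ex_derive_continuous;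
        eexists; exact D).
  assert (Drift : forall w, s <= w <= s + gamma ->
    Rabs (xa w - xa s) <= K * gamma /\ Rabs (ya w - ya s) <= 2 * Y * gamma).
  { intros w Hw. split.
    - apply Rle_trans with (K * (w - s)); [|apply Rmult_le_compat_l; lra].
      apply (mvt_bound xa (fun t => - v (xa t))); [lra | lra | intros; apply Cx; lra |].
      intros t Ht. destruct (Hsol t ltac:(lra)) as (D1 & _ & I & _). split; [exact D1|].
      rewrite Rabs_Ropp. apply Hb, I.
    - apply Rle_trans with (2 * Y * (w - s)); [|apply Rmult_le_compat_l; lra].
      apply (mvt_bound ya (fun t => a (xa t) - ya t)); [lra | lra | intros; apply Cy; lra |].
      intros t Ht. destruct (Hsol t ltac:(lra)) as (_ & D2 & I & I2). split; [exact D2|].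
      destruct (Hb _ I) as [Hb1 _]. unfold Rminus. eapply Rle_trans; [apply Rabs_triang|].
      rewrite Rabs_Ropp. lra. }
  destruct (Hsol s Hs) as (_ & _ & Is & _).
  assert (Hgg : 0 <= gamma * gamma) by nra.
  assert (HM : 0 <= (K * K + 2 * Y) * gamma) by (apply Rmult_le_pos; nra).
  assert (Ilin : forall k t, is_derive (fun t => (t - s) * k) t k)
    by (intros; auto_derive; [trivial | ring]).
  split.
  - replace (xa (s + gamma) - xa s + gamma * v (xa s)) with
      ((xa (s + gamma) + (s + gamma - s) * v (xa s)) - (xa s + (s - s) * v (xa s))) by ring.
    replace ((K * K + 2 * Y) * gamma ^ 2) with
      ((K * K + 2 * Y) * gamma * (s + gamma - s)) by ring.
    apply (mvt_bound (fun t => xa t + (t - s) * v (xa s)) (fun t => - v (xa t) + v (xa s)));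
      [lra | exact HM | |].
    + intros t Ht. apply (continuous_plus xa (fun t => (t - s) * v (xa s))); [apply Cx; lra|].
      apply @ex_derive_continuous. eexists. apply Ilin.
    + intros t Ht. destruct (Hsol t ltac:(lra)) as (D1 & _ & I & _). split.
      * apply (is_derive_plus xa (fun t => (t - s) * v (xa s))); [exact D1 | apply Ilin].
      * replace (- v (xa t) + v (xa s)) with (- (v (xa t) - v (xa s))) by ring.
        rewrite Rabs_Ropp. eapply Rle_trans; [apply Hlv; assumption|].
        destruct (Drift t ltac:(lra)) as [H1 _].
        apply Rle_trans with (K * (K * gamma)); [apply Rmult_le_compat_l; lra|]. nra.
  - replace (ya (s + gamma) - ya s - gamma * (a (xa s) - ya s)) with
      ((ya (s + gamma) + (s + gamma - s) * (- (a (xa s) - ya s))) -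
       (ya s + (s - s) * (- (a (xa s) - ya s)))) by ring.
    replace ((K * K + 2 * Y) * gamma ^ 2) with
      ((K * K + 2 * Y) * gamma * (s + gamma - s)) by ring.
    apply (mvt_bound (fun t => ya t + (t - s) * (- (a (xa s) - ya s)))
      (fun t => a (xa t) - ya t + - (a (xa s) - ya s))); [lra | exact HM | |].
    + intros t Ht. apply (continuous_plus ya (fun t => (t - s) * (- (a (xa s) - ya s))));
        [apply Cy; lra|].
      apply @ex_derive_continuous. eexists. apply Ilin.
    + intros t Ht. destruct (Hsol t ltac:(lra)) as (_ & D2 & I & _). split.
      * apply (is_derive_plus ya (fun t => (t - s) * (- (a (xa s) - ya s))));
          [exact D2 | apply Ilin].
      * replace (a (xa t) - ya t + - (a (xa s) - ya s)) with
          ((a (xa t) - a (xa s)) + - (ya t - ya s)) by ring.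
        eapply Rle_trans; [apply Rabs_triang|]. rewrite Rabs_Ropp.
        destruct (Drift t ltac:(lra)) as [H1 H2]. generalize (Hla _ _ I Is).
        assert (K * Rabs (xa t - xa s) <= K * (K * gamma)) by (apply Rmult_le_compat_l; lra).
        lra.
Qed.

Lemma euler_deviation_step (gamma K C C' x x' y y' X X' Y Y' ax vx aX vX : R) :
  0 < gamma <= 1 -> 0 <= K ->
  Rabs (x' - x + gamma * vx) <= C * gamma ^ 2 ->
  Rabs (y' - y - gamma * (ax - y)) <= C * gamma ^ 2 ->
  Rabs (X' - X + gamma * vX) <= C' * gamma ^ 2 ->
  Rabs (Y' - Y - gamma * (aX - Y)) <= C' * gamma ^ 2 ->
  Rabs (ax - aX) <= K * Rabs (x - X) -> Rabs (vx - vX) <= K * Rabs (x - X) ->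
  Rabs (x' - X') + Rabs (y' - Y')
    <= (1 + 2 * K * gamma) * (Rabs (x - X) + Rabs (y - Y)) + 2 * (C + C') * gamma ^ 2.
Proof.
  intros Hg HK H1 H2 H3 H4 H5 H6.
  assert (E1 : Rabs (x' - X') <= Rabs (x - X) + gamma * (K * Rabs (x - X)) +
    C * gamma ^ 2 + C' * gamma ^ 2).
  { replace (x' - X') with ((x - X) + (- (gamma * (vx - vX)) +
      ((x' - x + gamma * vx) + - (X' - X + gamma * vX)))) by ring.
    eapply Rle_trans; [apply Rabs_triang|].
    eapply Rle_trans; [apply Rplus_le_compat_l, Rabs_triang|].
    eapply Rle_trans; [apply Rplus_le_compat_l, Rplus_le_compat_l, Rabs_triang|].
    rewrite !Rabs_Ropp, Rabs_mult, (Rabs_pos_eq gamma) by lra.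
    assert (gamma * Rabs (vx - vX) <= gamma * (K * Rabs (x - X)))
      by (apply Rmult_le_compat_l; lra). lra. }
  assert (E2 : Rabs (y' - Y') <= (1 - gamma) * Rabs (y - Y) + gamma * (K * Rabs (x - X)) +
    C * gamma ^ 2 + C' * gamma ^ 2).
  { replace (y' - Y') with ((1 - gamma) * (y - Y) + (gamma * (ax - aX) +
      ((y' - y - gamma * (ax - y)) + - (Y' - Y - gamma * (aX - Y))))) by ring.
    eapply Rle_trans; [apply Rabs_triang|].
    eapply Rle_trans; [apply Rplus_le_compat_l, Rabs_triang|].
    eapply Rle_trans; [apply Rplus_le_compat_l, Rplus_le_compat_l, Rabs_triang|].
    rewrite !Rabs_Ropp, !Rabs_mult, (Rabs_pos_eq gamma), (Rabs_pos_eq (1 - gamma)) by lra.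
    assert (gamma * Rabs (ax - aX) <= gamma * (K * Rabs (x - X)))
      by (apply Rmult_le_compat_l; lra). lra. }
  assert (0 <= gamma * Rabs (y - Y)) by (apply Rmult_le_pos; [lra | apply Rabs_pos]).
  assert (0 <= K * gamma * Rabs (y - Y))
    by (repeat apply Rmult_le_pos; try lra; apply Rabs_pos).
  lra.
Qed.

(** [err_bound] is the fixed point of [output_error_step] for the Lipschitz constant L of a and the
    bound L delta of v, hence an invariant bound for |y - a(x)|. [rate_bound] is the bound it gives
    on |h - y| within a period, [local_error] the resulting coefficient of gamma^2. *)
Definition err_bound (L delta : R) : R := L * (L * delta) + 1.
Definition rate_bound (L delta : R) : R := 2 * (2 * L * delta + err_bound L delta).
Definition local_error (L delta : R) : R := (L + 1) * rate_bound L delta.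

Lemma err_bound_pos (L delta : R) : 0 < L -> 0 < delta -> 1 <= err_bound L delta.
Proof.
  intros HL Hd. unfold err_bound.
  assert (0 <= L * (L * delta)) by (repeat apply Rmult_le_pos; lra). lra.
Qed.

Lemma rate_bound_pos (L delta : R) : 0 < L -> 0 < delta -> 0 < rate_bound L delta.
Proof.
  intros HL Hd. unfold rate_bound.
  assert (H := err_bound_pos L delta HL Hd). assert (0 < L * delta) by nra. lra.
Qed.

Lemma local_error_pos (L delta : R) : 0 < L -> 0 < delta -> 0 < local_error L delta.
Proof.
  intros HL Hd. apply Rmult_lt_0_compat; [lra | apply rate_bound_pos; assumption].
Qed.

(** * Confinement, descent and comparison of a trajectory with the average system *)

Section Trajectory.

Variables (h a v : R -> R) (delta L xs r gamma p q eta c r0 : R) (T : Rbar) (x y : R -> R).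

Hypothesis Hh : forall x, continuous h x.
Hypothesis Hdelta : 0 < delta.
Hypothesis HL : 0 < L.
Hypothesis Hlip : lipschitz_on (fun x => xs - r <= x <= xs + r) L h.
Hypothesis Ha : forall x, avg_a h delta x = a x.
Hypothesis Hv : forall x, avg_v h delta x = v x.
Hypothesis Hpq : p <= q.
Hypothesis Hp : xs - delta <= p.
Hypothesis Hq : q <= xs + delta.
Hypothesis Heta : 0 < eta <= / 4.
Hypothesis Hr : 3 * eta + 2 * delta < r.
Hypothesis Hr0 : 3 * eta + r0 + delta < r.
Hypothesis Hc : 0 < c.
Hypothesis Hvq : forall z, q + eta <= z -> c <= v z.
Hypothesis Hvp : forall z, z <= p - eta -> v z <= - c.
Hypothesis Hg : 0 < gamma <= 1.
Hypothesis HgL : gamma * (L + 1) <= / 2.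
Hypothesis HgC : gamma * ((L + 1) * local_error L delta) <= 1.
Hypothesis HgF : gamma * rate_bound L delta <= eta.
Hypothesis Hgc : gamma * local_error L delta <= c / 2.

Hypothesis Hcont : forall t, 0 <= t -> Rbar_lt t T -> continuous x t /\ continuous y t.
Hypothesis Hder : forall t, 0 < t -> Rbar_lt t T -> Rabs (x t - xs) <= r - delta ->
  is_derive x t (- gamma * (h (x t + delta * dither t) - y t) * dither t) /\
  is_derive y t (gamma * (h (x t + delta * dither t) - y t)).
Hypothesis Hx0 : Rabs (x 0 - xs) <= r0.
Hypothesis Hy0 : Rabs (y 0 - a (x 0)) <= 1.

(** Under confinement the arguments x + delta u stay in [xs - r, xs + r], where L is valid. [Hder]
    asks for the equation only there, so that the section also covers solutions of the system with
    truncated h. *)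
Definition confined (u : R) : Prop := forall s, 0 <= s <= u -> Rabs (x s - xs) <= r - delta.

Lemma confined_inside z : Rabs (z - xs) <= r - delta ->
  inside delta (fun x => xs - r <= x <= xs + r) z.
Proof.
  intros Hz s Hs. apply Rabs_le_between in Hz, Hs.
  assert (0 <= delta * (s + 1)) by (apply Rmult_le_pos; lra).
  assert (0 <= delta * (1 - s)) by (apply Rmult_le_pos; lra). lra.
Qed.

Lemma a_lipschitz z w : Rabs (z - xs) <= r - delta -> Rabs (w - xs) <= r - delta ->
  Rabs (a z - a w) <= L * Rabs (z - w).
Proof.
  intros Hz Hw. rewrite <- !Ha.
  apply (avg_a_lipschitz h delta Hh _ L Hlip); apply confined_inside; assumption.
Qed.

Lemma v_bound z : Rabs (z - xs) <= r - delta -> Rabs (v z) <= L * delta.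
Proof.
  intros Hz. rewrite <- Hv.
  apply (avg_v_bound h delta Hh Hdelta _ L Hlip); [lra | apply confined_inside, Hz].
Qed.

Lemma Rbar_lt_le (s t : R) : s <= t -> Rbar_lt t T -> Rbar_lt s T.
Proof. intros Hst Ht. apply (Rbar_le_lt_trans s t T); [exact Hst | exact Ht]. Qed.

Lemma confined_drift (u : R) (n : nat) (s : R) :
  Rbar_lt u T -> confined u -> INR n <= s <= u -> s <= INR n + 1 ->
  Rabs (y (INR n) - a (x (INR n))) <= err_bound L delta ->
  Rabs (x s - x (INR n)) <= eta /\ Rabs (y s - y (INR n)) <= eta.
Proof.
  intros HuT Hu Hs Hs1 He. assert (Hn := pos_INR n).
  destruct (one_period_drift h delta Hh Hdelta (fun x => xs - r <= x <= xs + r) L Hlip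
     (Rlt_le _ _ HL) gamma (err_bound L delta) n (s - INR n) x y) with (s := s) as [H1 H2];
    try lra.
  - intros w Hw. apply Hcont; [lra | apply (Rbar_lt_le w u); [lra | exact HuT]].
  - intros w Hw. apply Hcont; [lra | apply (Rbar_lt_le w u); [lra | exact HuT]].
  - intros w Hw. apply Hder; [lra | apply (Rbar_lt_le w u); [lra | exact HuT] | apply Hu; lra].
  - intros w Hw. apply Hder; [lra | apply (Rbar_lt_le w u); [lra | exact HuT] | apply Hu; lra].
  - intros w Hw. apply confined_inside, Hu. lra.
  - rewrite Ha. exact He.
  - fold (rate_bound L delta) in H1, H2. lra.
Qed.

Lemma confined_step (u : R) (n : nat) :
  Rbar_lt u T -> confined u -> INR n + 1 <= u ->
  Rabs (y (INR n) - a (x (INR n))) <= err_bound L delta ->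
  Rabs (x (INR n + 1) - x (INR n) + gamma * v (x (INR n)))
    <= local_error L delta * gamma ^ 2 /\
  Rabs (y (INR n + 1) - y (INR n) - gamma * (a (x (INR n)) - y (INR n)))
    <= local_error L delta * gamma ^ 2.
Proof.
  intros HuT Hu Hnu He. assert (Hn := pos_INR n).
  rewrite <- Ha, <- Hv.
  apply (one_period_step h delta Hh Hdelta (fun x => xs - r <= x <= xs + r) L Hlip
     (Rlt_le _ _ HL) gamma (err_bound L delta) n 1 x y); try lra.
  - intros w Hw. apply Hcont; [lra | apply (Rbar_lt_le w u); [lra | exact HuT]].
  - intros w Hw. apply Hcont; [lra | apply (Rbar_lt_le w u); [lra | exact HuT]].
  - intros w Hw. apply Hder; [lra | apply (Rbar_lt_le w u); [lra | exact HuT] | apply Hu; lra].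
  - intros w Hw. apply Hder; [lra | apply (Rbar_lt_le w u); [lra | exact HuT] | apply Hu; lra].
  - intros w Hw. apply confined_inside, Hu. lra.
  - rewrite Ha. exact He.
Qed.

Lemma confined_error_step (u K V : R) (n : nat) :
  Rbar_lt u T -> confined u -> INR n + 1 <= u -> 0 <= K -> 0 <= V ->
  Rabs (y (INR n) - a (x (INR n))) <= err_bound L delta ->
  Rabs (a (x (INR n + 1)) - a (x (INR n))) <= K * Rabs (x (INR n + 1) - x (INR n)) ->
  Rabs (v (x (INR n))) <= V ->
  Rabs (y (INR n + 1) - a (x (INR n + 1)))
    <= (1 - gamma) * Rabs (y (INR n) - a (x (INR n))) + gamma * (K * V + 1).
Proof.
  intros HuT Hu Hnu HK HV He HaK HvV. assert (Hn := pos_INR n).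
  destruct (confined_step u n HuT Hu Hnu He) as [H1 H2].
  generalize (local_error_pos L delta HL Hdelta). intros HC.
  apply (output_error_step gamma L K V (local_error L delta)
    (x (INR n)) (x (INR n + 1)) _ _ _ _ (v (x (INR n)))); try lra.
  apply a_lipschitz; apply Hu; lra.
Qed.

(** The three bounds are carried in one induction: the period estimates behind the bounds on x
    require the bound on y - a(x). Each bound on x descends linearly in slow time at rate c / 2
    until it reaches the 2 eta neighbourhood of [p, q]. *)
Lemma confined_grid (u : R) : Rbar_lt u T -> confined u -> forall n, INR n <= u ->
  Rabs (y (INR n) - a (x (INR n))) <= err_bound L delta /\
  x (INR n) <= Rmax (x 0 - gamma * INR n * (c / 2)) (q + 2 * eta) /\
  - x (INR n) <= Rmax (- x 0 - gamma * INR n * (c / 2)) (- p + 2 * eta).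
Proof.
  intros HuT Hu. induction n as [|n IH]; intros Hnu.
  - change (INR 0) with 0. replace (gamma * 0 * (c / 2)) with 0 by ring. rewrite !Rminus_0_r.
    split; [generalize (err_bound_pos L delta HL Hdelta); lra|]. split; apply Rmax_l.
  - rewrite S_INR in Hnu |- *. assert (Hn := pos_INR n).
    destruct (IH ltac:(lra)) as (I1 & I2 & I3).
    destruct (confined_step u n HuT Hu Hnu I1) as [S1 _].
    destruct (confined_drift u n (INR n + 1) HuT Hu ltac:(lra) ltac:(lra) I1) as [S2 _].
    split; [|split].
    + eapply Rle_trans.
      * apply (confined_error_step u L (L * delta)); auto; try nra.
        -- apply a_lipschitz; apply Hu; lra.
        -- apply v_bound, Hu. lra.
      * fold (err_bound L delta).
        assert ((1 - gamma) * Rabs (y (INR n) - a (x (INR n))) <= (1 - gamma) * err_bound L delta)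
          by (apply Rmult_le_compat_l; lra). lra.
    + rewrite <- S_INR in S1, S2 |- *. apply (drift_step gamma (local_error L delta) c eta q (x (INR n))
        _ (v (x (INR n)))); auto; lra.
    + rewrite <- S_INR in S1, S2 |- *. apply (drift_step gamma (local_error L delta) c eta (- p) (- x (INR n))
        _ (- v (x (INR n)))); auto; try lra.
      * replace (- x (INR (S n)) - - x (INR n)) with (- (x (INR (S n)) - x (INR n))) by ring.
        rewrite Rabs_Ropp. exact S2.
      * replace (- x (INR (S n)) - - x (INR n) + gamma * - v (x (INR n))) with
          (- (x (INR (S n)) - x (INR n) + gamma * v (x (INR n)))) by ring.
        rewrite Rabs_Ropp. exact S1.
      * intros H. generalize (Hvp (x (INR n)) ltac:(lra)). lra.
Qed.

(** At the last grid point x is within max(r0, delta + 2 eta) of xs, and less than a period adds at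
    most eta. The hypotheses [Hr] and [Hr0] keep the sum strictly below r - delta. *)
Lemma confinement_improves (u : R) : 0 <= u -> Rbar_lt u T -> confined u ->
  Rabs (x u - xs) < r - delta.
Proof.
  intros Hu0 HuT Hu.
  destruct (nfloor_ex u Hu0) as [n Hn]. assert (Hn0 := pos_INR n).
  destruct (confined_grid u HuT Hu n ltac:(lra)) as (G1 & G2 & G3).
  destruct (confined_drift u n u HuT Hu ltac:(lra) ltac:(lra) G1) as [D _].
  apply Rabs_le_between in D. apply Rabs_le_between in Hx0.
  assert (0 <= gamma * INR n * (c / 2)) by (repeat apply Rmult_le_pos; lra).
  assert (x (INR n) <= Rmax (xs + r0) (xs + delta + 2 * eta)).
  { eapply Rle_trans; [exact G2|]. apply Rmax_le_compat; lra. }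
  assert (- x (INR n) <= Rmax (- xs + r0) (- xs + delta + 2 * eta)).
  { eapply Rle_trans; [exact G3|]. apply Rmax_le_compat; lra. }
  revert H0 H1. unfold Rmax.
  do 2 destruct (Rle_dec _ _); intros; apply Rabs_def1; lra.
Qed.

Lemma confinement (u : R) : 0 <= u -> Rbar_lt u T -> Rabs (x u - xs) < r - delta.
Proof.
  intros Hu HuT.
  apply (bootstrap (fun t => Rabs (x t - xs)) u (r - delta) Hu).
  - intros t Ht. apply (continuous_comp (fun t => x t - xs) Rabs); [|apply continuous_Rabs_id].
    apply (continuous_minus x (fun _ => xs)); [|apply continuous_const].
    apply Hcont; [lra | apply (Rbar_lt_le t u); [lra | exact HuT]].
  - lra.
  - intros t Ht Hconf. apply confinement_improves; [lra | | exact Hconf].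
    apply (Rbar_lt_le t u); [lra | exact HuT].
Qed.

Lemma confined_all (u : R) : Rbar_lt u T -> confined u.
Proof.
  intros HuT s Hs. apply Rlt_le, confinement; [lra|].
  apply (Rbar_lt_le s u); [lra | exact HuT].
Qed.

Lemma trajectory_bounded : exists B, forall t, 0 <= t -> Rbar_lt t T ->
  Rabs (x t) + Rabs (y t) <= B.
Proof.
  exists (Rabs xs + r + (1 + err_bound L delta + Rabs (a xs) + L * r)).
  intros t Ht HtT.
  destruct (nfloor_ex t Ht) as [n Hn]. assert (Hn0 := pos_INR n).
  assert (Hconf := confined_all t HtT).
  destruct (confined_grid t HtT Hconf n ltac:(lra)) as (G1 & _).
  destruct (confined_drift t n t HtT Hconf ltac:(lra) ltac:(lra) G1) as [_ D].
  assert (Hxt := Hconf t ltac:(lra)). assert (Hxn := Hconf (INR n) ltac:(lra)).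
  assert (Hxs : Rabs (xs - xs) <= r - delta) by (rewrite Rminus_diag, Rabs_R0; lra).
  assert (Hal := a_lipschitz _ _ Hxn Hxs).
  assert (L * Rabs (x (INR n) - xs) <= L * r) by (apply Rmult_le_compat_l; lra).
  replace (x t) with (xs + (x t - xs)) by ring.
  replace (y t) with ((y t - y (INR n)) + ((y (INR n) - a (x (INR n))) +
    (a xs + (a (x (INR n)) - a xs)))) by ring.
  generalize (Rabs_triang xs (x t - xs)),
   (Rabs_triang (y t - y (INR n)) ((y (INR n) - a (x (INR n))) + (a xs + (a (x (INR n)) - a xs)))),
   (Rabs_triang (y (INR n) - a (x (INR n))) (a xs + (a (x (INR n)) - a xs))),
   (Rabs_triang (a xs) (a (x (INR n)) - a xs)).
  lra.
Qed.

(** The location is expressed relative to [p, q] instead of xs, so that constants of the average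
    system on this interval can be used. *)
Lemma grid_region (n : nat) : Rbar_lt (INR n) T ->
  p - (r0 + delta + 1) <= x (INR n) <= q + (r0 + delta + 1).
Proof.
  intros HnT. assert (Hn := pos_INR n).
  destruct (confined_grid (INR n) HnT (confined_all _ HnT) n (Rle_refl _)) as (_ & G1 & G2).
  assert (0 <= r0) by (eapply Rle_trans; [apply Rabs_pos | exact Hx0]).
  apply Rabs_le_between in Hx0.
  assert (0 <= gamma * INR n * (c / 2)) by (repeat apply Rmult_le_pos; lra).
  assert (Rmax (x 0 - gamma * INR n * (c / 2)) (q + 2 * eta) <= q + (r0 + delta + 1))
    by (apply Rmax_lub; lra).
  assert (Rmax (- x 0 - gamma * INR n * (c / 2)) (- p + 2 * eta) <= - p + (r0 + delta + 1))
    by (apply Rmax_lub; lra).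
  lra.
Qed.

Lemma grid_region_late (n : nat) : Rbar_lt (INR n) T ->
  r0 + delta <= gamma * INR n * (c / 2) -> p - 1 <= x (INR n) <= q + 1.
Proof.
  intros HnT Hlate. assert (Hn := pos_INR n).
  destruct (confined_grid (INR n) HnT (confined_all _ HnT) n (Rle_refl _)) as (_ & G1 & G2).
  apply Rabs_le_between in Hx0.
  (* By now the linear bound is at most xs - delta <= p, so the maximum is q + 2 eta. *)
  assert (Rmax (x 0 - gamma * INR n * (c / 2)) (q + 2 * eta) <= q + 1)
    by (apply Rmax_lub; lra).
  assert (Rmax (- x 0 - gamma * INR n * (c / 2)) (- p + 2 * eta) <= - p + 1)
    by (apply Rmax_lub; lra).
  lra.
Qed.

Lemma grid_error (n : nat) : Rbar_lt (INR n) T ->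
  Rabs (y (INR n) - a (x (INR n))) <= err_bound L delta.
Proof.
  intros HnT. apply (confined_grid (INR n) HnT (confined_all _ HnT) n (Rle_refl _)).
Qed.

Lemma region_error_step (lo hi K : R) (n : nat) :
  Rbar_lt (INR n + 1) T -> 0 <= K ->
  lipschitz_on (fun z => lo <= z <= hi) K a ->
  (forall z, lo <= z <= hi -> Rabs (v z) <= K) ->
  lo <= x (INR n) <= hi -> lo <= x (INR n + 1) <= hi ->
  Rabs (y (INR n + 1) - a (x (INR n + 1)))
    <= (1 - gamma) * Rabs (y (INR n) - a (x (INR n))) + gamma * (K * K + 1).
Proof.
  intros HnT HK Hla HvK Hn Hn1.
  apply (confined_error_step (INR n + 1) K K n HnT (confined_all _ HnT) (Rle_refl _) HK HK).
  - apply grid_error, (Rbar_lt_le _ (INR n + 1)); [lra | exact HnT].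
  - apply Hla; assumption.
  - apply HvK, Hn.
Qed.

(** The same invariance as for [err_bound], with constants of the average system in place of L and L
    delta; the decay time computed from this bound is thus free of L. *)
Lemma grid_error_region (K : R) : 0 <= K ->
  lipschitz_on (fun z => p - (r0 + delta + 1) <= z <= q + (r0 + delta + 1)) K a ->
  (forall z, p - (r0 + delta + 1) <= z <= q + (r0 + delta + 1) -> Rabs (v z) <= K) ->
  forall n, Rbar_lt (INR n) T -> Rabs (y (INR n) - a (x (INR n))) <= K * K + 1.
Proof.
  intros HK Hla HvK. induction n as [|n IH]; intros HnT.
  - change (INR 0) with 0. nra.
  - assert (HnT0 : Rbar_lt (INR n) T).
    { apply (Rbar_lt_le _ (INR (S n))); [rewrite S_INR; lra | exact HnT]. }
    assert (R1 := grid_region (S n) HnT). rewrite S_INR in *.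
    eapply Rle_trans; [apply (region_error_step _ _ K n HnT HK Hla HvK); auto|].
    + apply grid_region, HnT0.
    + specialize (IH HnT0).
      assert ((1 - gamma) * Rabs (y (INR n) - a (x (INR n))) <= (1 - gamma) * (K * K + 1))
        by (apply Rmult_le_compat_l; lra). lra.
Qed.

Lemma late_monotone (n n' : nat) : (n <= n')%nat ->
  r0 + delta <= gamma * INR n * (c / 2) -> r0 + delta <= gamma * INR n' * (c / 2).
Proof.
  intros Hnn H. eapply Rle_trans; [exact H|].
  apply Rmult_le_compat_r; [lra|]. apply Rmult_le_compat_l; [lra|]. apply le_INR, Hnn.
Qed.

(** Once x is near [p, q], the step contracts towards K K + 1 with K taken on [p - 1, q + 1]. The
    set from which the comparison starts is therefore independent of r0 and L. *)
Lemma grid_error_late (K B : R) (n1 : nat) : 0 <= K ->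
  lipschitz_on (fun z => p - 1 <= z <= q + 1) K a ->
  (forall z, p - 1 <= z <= q + 1 -> Rabs (v z) <= K) ->
  r0 + delta <= gamma * INR n1 * (c / 2) ->
  (forall n, Rbar_lt (INR n) T -> Rabs (y (INR n) - a (x (INR n))) <= B) ->
  forall k, Rbar_lt (INR (n1 + k)) T ->
  Rabs (y (INR (n1 + k)) - a (x (INR (n1 + k)))) <= K * K + 1 + (1 - gamma) ^ k * B.
Proof.
  intros HK Hla HvK Hlate HB. induction k as [|k IH]; intros HkT.
  - rewrite Nat.add_0_r in *. simpl. specialize (HB n1 HkT). nra.
  - rewrite Nat.add_succ_r in HkT |- *.
    assert (HkT0 : Rbar_lt (INR (n1 + k)) T).
    { apply (Rbar_lt_le _ (INR (S (n1 + k)))); [rewrite S_INR; lra | exact HkT]. }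
    assert (R0 := grid_region_late _ HkT0 (late_monotone n1 (n1 + k) ltac:(lia) Hlate)).
    assert (R1 := grid_region_late _ HkT (late_monotone n1 (S (n1 + k)) ltac:(lia) Hlate)).
    rewrite S_INR in *.
    eapply Rle_trans; [apply (region_error_step _ _ K _ HkT HK Hla HvK); auto|].
    specialize (IH HkT0).
    assert ((1 - gamma) * Rabs (y (INR (n1 + k)) - a (x (INR (n1 + k))))
      <= (1 - gamma) * (K * K + 1 + (1 - gamma) ^ k * B)) by (apply Rmult_le_compat_l; lra).
    simpl ((1 - gamma) ^ S k). lra.
Qed.

Lemma averaging_error (K Y : R) (n0 N : nat) (xa ya : R -> R) : 0 < K -> K <= Y ->
  lipschitz_on (fun z => p - 1 <= z <= q + 1) K a ->
  lipschitz_on (fun z => p - 1 <= z <= q + 1) K v ->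
  (forall z, p - 1 <= z <= q + 1 -> Rabs (a z) <= K /\ Rabs (v z) <= K) ->
  (forall t, 0 <= t -> is_derive xa t (- v (xa t)) /\ is_derive ya t (a (xa t) - ya t) /\
     p - 1 <= xa t <= q + 1 /\ Rabs (ya t) <= Y) ->
  xa 0 = x (INR n0) -> ya 0 = y (INR n0) ->
  r0 + delta <= gamma * INR n0 * (c / 2) -> Rbar_lt (INR (n0 + N)) T ->
  Rabs (x (INR (n0 + N)) - xa (gamma * INR N)) + Rabs (y (INR (n0 + N)) - ya (gamma * INR N))
    <= 2 * (local_error L delta + (K * K + 2 * Y)) * gamma ^ 2 * INR N
       * exp (2 * K * gamma * INR N).
Proof.
  intros HK HKY Hla Hlv Hb Hsol Hxa0 Hya0 Hlate HNT.
  assert (HC := local_error_pos L delta HL Hdelta).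
  apply (discrete_gronwall (fun k => Rabs (x (INR (n0 + k)) - xa (gamma * INR k)) +
    Rabs (y (INR (n0 + k)) - ya (gamma * INR k)))).
  - nra.
  - apply Rmult_le_pos; [nra | apply pow2_ge_0].
  - change (INR 0) with 0. rewrite Nat.add_0_r, Rmult_0_r, Hxa0, Hya0, !Rminus_diag, Rabs_R0.
    ring.
  - intros k Hk.
    assert (HkT : Rbar_lt (INR (n0 + k) + 1) T).
    { apply (Rbar_lt_le _ (INR (n0 + N))); [|exact HNT].
      rewrite <- S_INR. apply le_INR. lia. }
    assert (HkT0 : Rbar_lt (INR (n0 + k)) T) by (apply (Rbar_lt_le _ (INR (n0 + k) + 1)); [lra | exact HkT]).
    destruct (confined_step _ (n0 + k) HkT (confined_all _ HkT) (Rle_refl _)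
      (grid_error _ HkT0)) as [S1 S2].
    assert (Hk0 : 0 <= gamma * INR k) by (apply Rmult_le_pos; [lra | apply pos_INR]).
    destruct (average_step a v (p - 1) (q + 1) K Y gamma xa ya (gamma * INR k))
      as [S3 S4]; auto; try lra.
    replace (n0 + (k + 1))%nat with (S (n0 + k)) by lia.
    replace (k + 1)%nat with (S k) by lia. rewrite !S_INR.
    replace (gamma * (INR k + 1)) with (gamma * INR k + gamma) by ring.
    assert (Rg := grid_region_late _ HkT0 (late_monotone n0 (n0 + k) ltac:(lia) Hlate)).
    destruct (Hsol (gamma * INR k) Hk0) as (_ & _ & Ra & _).
    eapply euler_deviation_step; eauto; try lra.
Qed.

(** Before a late time t there is room for N1 periods of descent in x, N2 periods of decay of y -
    a(x), and a window of N periods ending at the last grid point. [P] stands for whatever average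
    solutions satisfy after slow time Tw. *)
Lemma late_error_to_average (K Kr Y Tw w : R) (P : R -> R -> Prop) :
  0 < K -> 0 < Kr -> 0 <= Tw -> Y = K * K + 2 + K ->
  lipschitz_on (fun z => p - 1 <= z <= q + 1) K a ->
  lipschitz_on (fun z => p - 1 <= z <= q + 1) K v ->
  (forall z, p - 1 <= z <= q + 1 -> Rabs (a z) <= K /\ Rabs (v z) <= K) ->
  lipschitz_on (fun z => p - (r0 + delta + 1) <= z <= q + (r0 + delta + 1)) Kr a ->
  (forall z, p - (r0 + delta + 1) <= z <= q + (r0 + delta + 1) -> Rabs (v z) <= Kr) ->
  0 <= v (q + 1) -> v (p - 1) <= 0 ->
  (forall xa ya : R -> R,
     p - 1 <= xa 0 <= q + 1 -> Rabs (ya 0) <= Y ->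
     (forall t, 0 <= t -> is_derive xa t (- v (xa t)) /\ is_derive ya t (a (xa t) - ya t)) ->
     forall s, Tw <= s -> P (xa s) (ya s)) ->
  gamma * (2 * (local_error L delta + (K * K + 2 * Y)) * (Tw + 1) * exp (2 * K * (Tw + 1))) <= w ->
  forall t, 0 <= t -> Rbar_lt t T ->
  2 * (r0 + delta) / c + (Kr * Kr + 1) + Tw + 4 <= gamma * t ->
  exists X Z, P X Z /\ Rabs (x t - X) + Rabs (y t - Z) <= w + 2 * eta.
Proof.
  intros HK HKr HTw HY Hla Hlv Hb HlaR HbR Hvhi Hvlo HP Hgw t Ht HtT Hlate.
  assert (Hr00 : 0 <= r0) by (eapply Rle_trans; [apply Rabs_pos | exact Hx0]).
  assert (HN1p : 0 <= 2 * (r0 + delta) / c)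
    by (apply Rmult_le_pos; [lra | apply Rlt_le, Rinv_0_lt_compat; lra]).
  (* Slow durations are rounded up to whole periods at a cost of at most gamma <= 1 each; the 4 in
     the bound on t covers the three roundings. *)
  assert (Hceil : forall B, 0 <= B -> exists n, B <= gamma * INR n <= B + gamma).
  { intros B HB.
    destruct (nfloor_ex (B / gamma)) as [n Hn].
    { apply Rmult_le_pos; [lra | apply Rlt_le, Rinv_0_lt_compat; lra]. }
    exists (S n). rewrite S_INR.
    assert (E : B = gamma * (B / gamma)) by (field; lra).
    set (b := B / gamma) in *. nra. }
  destruct (Hceil _ HN1p) as [N1 HN1].
  destruct (Hceil (Kr * Kr + 1) ltac:(nra)) as [N2 HN2].
  destruct (Hceil Tw HTw) as [N HN].
  destruct (nfloor_ex t Ht) as [n Hn].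
  assert (Hsum : (N1 + N2 + N <= n)%nat).
  { assert (gamma * INR (N1 + N2 + N) < gamma * (INR n + 1)).
    { rewrite !plus_INR. apply Rlt_le_trans with (gamma * t); [lra|nra]. }
    apply Rmult_lt_reg_l in H; [|lra]. rewrite <- S_INR in H. apply INR_lt in H. lia. }
  assert (Hlate1 : r0 + delta <= gamma * INR N1 * (c / 2)).
  { replace (r0 + delta) with (2 * (r0 + delta) / c * (c / 2)) by (field; lra).
    apply Rmult_le_compat_r; lra. }
  set (n0 := (n - N)%nat).
  assert (Hn0 : (n0 + N)%nat = n) by (unfold n0; lia).
  assert (Hn0' : (n0 = N1 + (n0 - N1))%nat) by (unfold n0; lia).
  assert (HnT : Rbar_lt (INR n) T) by (apply (Rbar_lt_le _ t); [lra | exact HtT]).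
  assert (Hn0T : Rbar_lt (INR n0) T).
  { apply (Rbar_lt_le _ (INR n)); [apply le_INR; lia | exact HnT]. }
  assert (Hlate0 := late_monotone N1 n0 ltac:(lia) Hlate1).
  assert (Hreg := grid_region_late n0 Hn0T Hlate0).
  (* The second 1 is what remains of the initial bound Kr Kr + 1 after N2 periods; adding |a| <= K
     gives the value of Y. *)
  assert (Herr : Rabs (y (INR n0) - a (x (INR n0))) <= K * K + 1 + 1).
  { assert (E := grid_error_late K (Kr * Kr + 1) N1 (Rlt_le _ _ HK) Hla
      (fun z Hz => proj2 (Hb z Hz)) Hlate1
      (grid_error_region Kr (Rlt_le _ _ HKr) HlaR HbR) (n0 - N1)).
    rewrite <- Hn0' in E. specialize (E Hn0T).
    assert ((1 - gamma) ^ (n0 - N1) * (Kr * Kr + 1) <= 1); [|lra].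
    apply pow_decay; [exact Hg|]. split; [nra|].
    eapply Rle_trans; [apply HN2|]. apply Rmult_le_compat_l; [lra|]. apply le_INR. lia. }
  assert (Hy : Rabs (y (INR n0)) <= Y).
  { replace (y (INR n0)) with ((y (INR n0) - a (x (INR n0))) + a (x (INR n0))) by ring.
    eapply Rle_trans; [apply Rabs_triang|].
    destruct (Hb _ Hreg) as [Hb1 _]. lra. }
  assert (HKY : K <= Y) by nra.
  destruct (average_solution a v (p - 1) (q + 1) K Y (x (INR n0)) (y (INR n0)))
    as (xa & ya & Hxa0 & Hya0 & Hsol); auto; try lra.
  { intros z Hz. destruct (Hb z Hz). lra. }
  exists (xa (gamma * INR N)), (ya (gamma * INR N)). split.
  - apply HP.
    + rewrite Hxa0. exact Hreg.
    + rewrite Hya0. exact Hy.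
    + intros s Hs. destruct (Hsol s Hs) as (D1 & D2 & _). auto.
    + apply HN.
  - assert (E := averaging_error K Y n0 N xa ya HK HKY Hla Hlv Hb Hsol Hxa0 Hya0 Hlate0).
    rewrite Hn0 in E. specialize (E HnT).
    (* Although N grows like 1 / gamma, gamma N is at most Tw + 1, so one power of gamma
       survives. *)
    assert (E2 : 2 * (local_error L delta + (K * K + 2 * Y)) * gamma ^ 2 * INR N
       * exp (2 * K * gamma * INR N) <= w).
    { eapply Rle_trans; [|exact Hgw].
      assert (HC := local_error_pos L delta HL Hdelta).
      assert (H1 : gamma * INR N <= Tw + 1) by lra.
      assert (H2 : exp (2 * K * gamma * INR N) <= exp (2 * K * (Tw + 1))).
      { assert (H3 : 2 * K * gamma * INR N <= 2 * K * (Tw + 1)) by nra.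
        destruct H3 as [H3| ->]; [apply Rlt_le, exp_increasing, H3 | lra]. }
      set (C := 2 * (local_error L delta + (K * K + 2 * Y))) in *.
      assert (HC0 : 0 <= C) by (unfold C; nra).
      replace (C * gamma ^ 2 * INR N * exp (2 * K * gamma * INR N)) with
        (gamma * (C * (gamma * INR N) * exp (2 * K * gamma * INR N))) by ring.
      apply Rmult_le_compat_l; [lra|].
      apply Rmult_le_compat; [apply Rmult_le_pos; lra | apply Rlt_le, exp_pos | | exact H2].
      apply Rmult_le_compat_l; lra. }
    destruct (confined_drift t n t HtT (confined_all t HtT) ltac:(lra) ltac:(lra)
      (grid_error n HnT)) as [D1 D2].
    generalize (Rabs_triang (x t - x (INR n)) (x (INR n) - xa (gamma * INR N))),
      (Rabs_triang (y t - y (INR n)) (y (INR n) - ya (gamma * INR N))).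
    replace (x t - x (INR n) + (x (INR n) - xa (gamma * INR N))) with
      (x t - xa (gamma * INR N)) by ring.
    replace (y t - y (INR n) + (y (INR n) - ya (gamma * INR N))) with
      (y t - ya (gamma * INR N)) by ring.
    lra.
Qed.

End Trajectory.

(** * Trajectories and constants of the average system *)

(** Clamping the argument of h makes the field globally Lipschitz with the same L, so the Picard
    theorem gives a solution for all t >= 0. *)
Lemma clamped_es_solution (h : R -> R) (xs r L delta gamma x0 y0 : R) :
  (forall x, continuous h x) -> 0 < r -> 0 < L ->
  lipschitz_on (fun x => xs - r <= x <= xs + r) L h -> 0 < gamma ->
  let g := fun x => h (clamp (xs - r) (xs + r) x) in
  exists x y : R -> R, x 0 = x0 /\ y 0 = y0 /\ forall t, 0 <= t ->
    is_derive x t (- gamma * (g (x t + delta * dither t) - y t) * dither t) /\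
    is_derive y t (gamma * (g (x t + delta * dither t) - y t)).
Proof.
  intros Hh Hr HL Hlip Hg g.
  assert (Hgl : forall x x', Rabs (g x - g x') <= L * Rabs (x - x')).
  { intros x x'. apply lipschitz_clamp; [lra | lra | exact Hlip]. }
  assert (Hgb : forall x, Rabs (g x) <= Rabs (h xs) + L * r).
  { intros x. replace (g x) with (h xs + (g x - h xs)) by ring.
    eapply Rle_trans; [apply Rabs_triang|]. apply Rplus_le_compat_l.
    assert (Hin := clamp_in (xs - r) (xs + r) x ltac:(lra)).
    eapply Rle_trans; [apply Hlip; lra|]. apply Rmult_le_compat_l; [lra|].
    apply Rabs_le. lra. }
  assert (Hgc : forall x, continuous g x).
  { intros x. apply locally_lipschitz_continuous. intros z. exists 1, L.
    split; [lra|]. intros; apply Hgl. }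
  set (F := fun (i : bool) (s x y : R) =>
    if i then - gamma * (g (x + delta * dither s) - y) * dither s
    else gamma * (g (x + delta * dither s) - y)).
  destruct (picard_exists F (gamma * (L + 1))
     (gamma * (Rabs (h xs) + L * r + Rabs y0)) (fun i => if i then x0 else y0))
     as (z & Hz0 & Hz).
  - apply Rmult_lt_0_compat; lra.
  - intros i s x y x' y'.
    assert (E : Rabs ((g (x + delta * dither s) - y) - (g (x' + delta * dither s) - y'))
      <= (L + 1) * (Rabs (x - x') + Rabs (y - y'))).
    { replace (_ - _) with ((g (x + delta * dither s) - g (x' + delta * dither s)) + - (y - y'))
        by ring.
      eapply Rle_trans; [apply Rabs_triang|]. rewrite Rabs_Ropp.
      generalize (Hgl (x + delta * dither s) (x' + delta * dither s)).
      replace (x + delta * dither s - (x' + delta * dither s)) with (x - x') by ring.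
      generalize (Rabs_pos (x - x')), (Rabs_pos (y - y')). intros.
      assert (0 <= L * Rabs (y - y')) by (apply Rmult_le_pos; lra). lra. }
    set (W := (g (x + delta * dither s) - y) - (g (x' + delta * dither s) - y')) in *.
    destruct i; unfold F.
    + replace (_ - _) with (- gamma * (W * dither s)) by (unfold W; ring).
      rewrite !Rabs_mult, Rabs_Ropp, (Rabs_pos_eq gamma), Rmult_assoc by lra.
      apply Rmult_le_compat_l; [lra|].
      generalize (dither_bound s), (Rabs_pos W), (Rabs_pos (dither s)). intros.
      rewrite <- (Rmult_1_r ((L + 1) * _)). apply Rmult_le_compat; lra.
    + replace (_ - _) with (gamma * W) by (unfold W; ring).
      rewrite Rabs_mult, (Rabs_pos_eq gamma), Rmult_assoc by lra.
      apply Rmult_le_compat_l; lra.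
  - intros i x y s.
    assert (C1 : continuous (fun s => gamma * (g (x + delta * dither s) - y)) s).
    { apply (continuous_scal_r gamma (fun s => g (x + delta * dither s) - y)).
      apply (continuous_minus (fun s => g (x + delta * dither s)) (fun _ => y));
        [|apply continuous_const].
      apply (continuous_shifted g delta Hgc). }
    destruct i; [|exact C1].
    apply (continuous_mult (fun s => - gamma * (g (x + delta * dither s) - y)) dither);
      [|apply continuous_dither].
    apply (continuous_ext (fun s => - (gamma * (g (x + delta * dither s) - y))));
      [intros w; apply Ropp_mult_distr_l|].
    apply (continuous_opp (fun s => gamma * (g (x + delta * dither s) - y))), C1.
  - intros i s. cbv beta iota.
    assert (E : Rabs (g (x0 + delta * dither s) - y0) <= Rabs (h xs) + L * r + Rabs y0).
    { unfold Rminus. eapply Rle_trans; [apply Rabs_triang|]. rewrite Rabs_Ropp.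
      generalize (Hgb (x0 + delta * dither s)). lra. }
    set (W := g (x0 + delta * dither s) - y0) in *.
    destruct i; unfold F; fold W; rewrite !Rabs_mult, ?Rabs_Ropp, (Rabs_pos_eq gamma) by lra.
    + rewrite Rmult_assoc. apply Rmult_le_compat_l; [lra|].
      generalize (dither_bound s), (Rabs_pos W), (Rabs_pos (dither s)). intros.
      rewrite <- (Rmult_1_r (_ + _)). apply Rmult_le_compat; lra.
    + apply Rmult_le_compat_l; lra.
  - exists (z true), (z false). split; [apply (Hz0 true)|]. split; [apply (Hz0 false)|].
    intros t Ht. split; [apply (Hz true t Ht) | apply (Hz false t Ht)].
Qed.

(** All these initial states are within a common distance [rho] of one point of the graph. As beta
    increases in its first argument, the decay of beta(rho, s) gives a window length valid for all
    of them. *)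
Lemma graph_window (a0 b1 tau : R -> R) (S : R -> Prop) (p q Y d : R) :
  (exists s, S s) -> (forall s, S s -> p <= s <= q) ->
  globally_asymptotically_stable (avg_field a0 b1 1) (graph_on tau S) ->
  0 < Y -> 0 < d ->
  exists Tw, 0 <= Tw /\ forall xa ya : R -> R,
    p - 1 <= xa 0 <= q + 1 -> Rabs (ya 0) <= Y ->
    (forall t, 0 <= t -> is_derive xa t (- (b1 (xa t) / 2)) /\
       is_derive ya t (a0 (xa t) / 2 - ya t)) ->
    forall s, Tw <= s -> dist_to (graph_on tau S) (xa s, ya s) <= d.
Proof.
  intros [s0 Hs0] HS (beta & (HbK & HbL) & Hgas) HY Hd.
  assert (HG : exists z, graph_on tau S z) by (exists (s0, tau s0); split; [exact Hs0 | reflexivity]).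
  set (rho := (q - p + 1) + (Y + Rabs (tau s0))).
  assert (Hrho : 0 <= rho).
  { unfold rho. generalize (HS s0 Hs0), (Rabs_pos (tau s0)). lra. }
  destruct (HbL rho Hrho) as [_ Hlim]. apply is_lim_spec in Hlim.
  destruct (Hlim (mkposreal d Hd)) as [M HM]. simpl in HM.
  exists (Rmax 0 M + 1). split; [generalize (Rmax_l 0 M); lra|].
  intros xa ya Hxa Hya Hder s Hs.
  assert (Hs1 : 0 <= s) by (generalize (Rmax_l 0 M); lra).
  assert (HsM : M < s) by (generalize (Rmax_r 0 M); lra).
  assert (Hsol : is_solution (avg_field a0 b1 1) p_infty (fun t => (xa t, ya t))).
  { apply is_solution_pair. intros t Ht. destruct (Hder t Ht) as [D1 D2].
    unfold avg_field; simpl fst; simpl snd.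
    replace (- (1) * (b1 (xa t) / 2)) with (- (b1 (xa t) / 2)) by ring.
    replace (- (1) * ya t + 1 * (a0 (xa t) / 2)) with (a0 (xa t) / 2 - ya t) by ring.
    split; assumption. }
  eapply Rle_trans; [apply (Hgas _ _ Hsol s Hs1 I)|].
  assert (Hd0 : dist_to (graph_on tau S) (xa 0, ya 0) <= rho).
  { eapply Rle_trans.
    - apply (dist_to_le _ HG _ (s0, tau s0)). split; [exact Hs0 | reflexivity].
    - eapply Rle_trans; [apply (norm_pair_le (xa 0 - s0) (ya 0 - tau s0))|].
      unfold rho. generalize (HS s0 Hs0), (Rabs_triang (ya 0) (- tau s0)).
      rewrite Rabs_Ropp. intros. apply Rplus_le_compat; [apply Rabs_le|unfold Rminus]; lra. }
  specialize (HM s HsM). rewrite Rminus_0_r in HM.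
  generalize (Rle_abs (beta rho s)). intros Habs.
  destruct (HbK s Hs1) as (_ & _ & Hmono).
  destruct Hd0 as [Hlt| ->]; [|lra].
  generalize (Hmono _ _ (dist_to_pos _ HG (xa 0, ya 0)) Hlt). lra.
Qed.

(** With q the supremum of S, the point q + r0 is at distance exactly r0. The bound on beta speaks
    of solutions, so one starting there is needed; it is then evaluated at t = 0. *)
Lemma beta_expands (a0 b1 : R -> R) (beta : R -> R -> R) (S : R -> Prop) (q r0 : R) :
  (exists s, S s) -> is_lub S q -> 0 <= r0 ->
  (forall (T : Rbar) (xa : R -> R), is_solution (avg_x_field b1 1) T xa ->
     forall t : R, 0 <= t -> Rbar_lt t T ->
     dist_to S (xa t) <= beta (dist_to S (xa 0)) (1 * t)) ->
  (exists x : R -> R, x 0 = q + r0 /\ forall t, 0 <= t -> is_derive x t (- (b1 (x t) / 2))) ->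
  r0 <= beta r0 0.
Proof.
  intros HS [Hub Hlub] Hr0 Hbeta (x & Hx0 & Hx).
  assert (Hsol : is_solution (avg_x_field b1 1) p_infty x).
  { split; [exact I|]. split.
    - eapply filterlim_filter_le_1; [apply filter_le_within|].
      apply @ex_derive_continuous. eexists. apply Hx. lra.
    - intros t Ht _. unfold avg_x_field.
      replace (- (1) * (b1 (x t) / 2)) with (- (b1 (x t) / 2)) by ring.
      apply Hx. lra. }
  generalize (Hbeta _ _ Hsol 0 (Rle_refl _) I). rewrite Rmult_0_r, Hx0.
  assert (E : dist_to S (q + r0) = r0).
  { apply Rle_antisym.
    - assert (q <= q + r0 - (dist_to S (q + r0) - r0) - r0); [|lra].
      apply Hlub. intros s Hs.
      generalize (dist_to_le S HS (q + r0) s Hs), (Hub s Hs).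
      change (norm (minus (q + r0) s)) with (Rabs (q + r0 - s)).
      intros H1 H2. rewrite Rabs_pos_eq in H1 by lra. lra.
    - apply (dist_to_ge S HS). intros s Hs. generalize (Hub s Hs).
      change (norm (minus (q + r0) s)) with (Rabs (q + r0 - s)).
      intros H. rewrite Rabs_pos_eq; lra. }
  rewrite E. auto.
Qed.

(** A zero of v outside [p, q] would have positive distance to S. The left side is the right side
    for the reflected field - v(- x). *)
Lemma attractor_margins (v : R -> R) (S : R -> Prop) (p q c0 lo hi : R) :
  (exists s, S s) -> (forall s, S s -> p <= s <= q) -> (forall x, continuous v x) ->
  (forall x, v x = 0 -> dist_to S x <= 0) ->
  0 < c0 -> (forall x, hi <= x -> c0 <= v x) -> (forall x, x <= lo -> v x <= - c0) ->
  forall eta, 0 < eta -> exists c, 0 < c /\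
    (forall x, q + eta <= x -> c <= v x) /\ (forall x, x <= p - eta -> v x <= - c).
Proof.
  intros HS Hpq Hv Hzero Hc0 Hhi Hlo eta Heta.
  destruct (positive_margin v q c0 hi Hv Hc0 Hhi) with (eta := eta) as (c1 & Hc1 & H1); auto.
  { intros x Hx Hvx. assert (H := Hzero x Hvx).
    assert (x - q <= dist_to S x); [|lra]. apply (dist_to_ge S HS). intros s Hs.
    change (norm (minus x s)) with (Rabs (x - s)). generalize (Hpq s Hs). intros.
    rewrite Rabs_pos_eq; lra. }
  destruct (positive_margin (fun x => - v (- x)) (- p) c0 (- lo)) with (eta := eta)
    as (c2 & Hc2 & H2); auto.
  { intros x. apply (continuous_opp (fun x => v (- x))).
    apply (continuous_comp Ropp v); [|apply Hv].
    apply (ex_derive_continuous (fun x : R => - x)). auto_derive. trivial. }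
  { intros x Hx. generalize (Hlo (- x) ltac:(lra)). lra. }
  { intros x Hx Hvx. assert (H := Hzero (- x) ltac:(lra)).
    assert (p + x <= dist_to S (- x)); [|lra]. apply (dist_to_ge S HS). intros s Hs.
    change (norm (minus (- x) s)) with (Rabs (- x - s)). generalize (Hpq s Hs). intros.
    rewrite Rabs_left1; lra. }
  exists (Rmin c1 c2). split; [apply Rmin_glb_lt; assumption|].
  generalize (Rmin_l c1 c2), (Rmin_r c1 c2). intros M1 M2. split; intros x Hx.
  - generalize (H1 x Hx). lra.
  - generalize (H2 (- x) ltac:(lra)). rewrite Ropp_involutive. lra.
Qed.

(** * Choice of the constants *)

(** The bound 1/4 keeps 2 eta neighbourhoods of [p, q] inside [p - 1, q + 1]; the bound d / 8 makes
    3 eta < d, for confinement, and 2 eta <= d / 4, for the final estimate. *)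
Definition margin (d : R) : R := Rmin (/ 4) (d / 8).

Definition output_bound (K : R) : R := K * K + 2 + K.

Definition window_error (K Tw L delta : R) : R :=
  2 * (local_error L delta + (K * K + 2 * output_bound K)) * (Tw + 1) * exp (2 * K * (Tw + 1)).

(** The numerator is below every required upper bound and the denominator above 1 and above every
    coefficient of gamma, so all smallness conditions hold together. *)
Definition threshold (K Tw c delta L d : R) : R :=
  Rmin (/ 2) (Rmin (margin d) (Rmin (c / 2) (d / 4))) /
  (1 + (L + 1) + (L + 1) * local_error L delta + rate_bound L delta +
   local_error L delta + window_error K Tw L delta).

Lemma margin_spec (d : R) : 0 < d -> 0 < margin d <= / 4 /\ margin d <= d / 8.
Proof.
  intros Hd. unfold margin. split; [split|].
  - apply Rmin_glb_lt; lra.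
  - apply Rmin_l.
  - apply Rmin_r.
Qed.

Lemma threshold_spec (K Tw c delta L d : R) :
  0 < K -> 0 <= Tw -> 0 < c -> 0 < delta -> 0 < L -> 0 < d ->
  0 < threshold K Tw c delta L d <= 1 /\
  forall gamma, 0 < gamma < threshold K Tw c delta L d ->
    gamma * (L + 1) <= / 2 /\
    gamma * ((L + 1) * local_error L delta) <= 1 /\
    gamma * rate_bound L delta <= margin d /\
    gamma * local_error L delta <= c / 2 /\
    gamma * window_error K Tw L delta <= d / 4.
Proof.
  intros HK HTw Hc Hdelta HL Hd.
  assert (P1 := local_error_pos L delta HL Hdelta).
  assert (P2 := rate_bound_pos L delta HL Hdelta).
  assert (P3 : 0 <= window_error K Tw L delta).
  { unfold window_error, output_bound. repeat apply Rmult_le_pos; try lra; try nra.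
    apply Rlt_le, exp_pos. }
  assert (P4 : 0 < (L + 1) * local_error L delta) by (apply Rmult_lt_0_compat; lra).
  destruct (margin_spec d Hd) as [Hm1 Hm2].
  unfold threshold.
  set (S := 1 + (L + 1) + (L + 1) * local_error L delta + rate_bound L delta +
   local_error L delta + window_error K Tw L delta).
  set (m := Rmin (/ 2) (Rmin (margin d) (Rmin (c / 2) (d / 4)))).
  assert (HS : 1 <= S) by (unfold S; lra).
  assert (Hm : 0 < m) by (unfold m; repeat apply Rmin_glb_lt; lra).
  assert (M1 : m <= / 2) by apply Rmin_l.
  assert (M2 : m <= margin d) by (eapply Rle_trans; [apply Rmin_r | apply Rmin_l]).
  assert (M3 : m <= c / 2).
  { eapply Rle_trans; [apply Rmin_r|]. eapply Rle_trans; [apply Rmin_r | apply Rmin_l]. }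
  assert (M4 : m <= d / 4).
  { eapply Rle_trans; [apply Rmin_r|]. eapply Rle_trans; [apply Rmin_r | apply Rmin_r]. }
  assert (HmS : m / S * S = m) by (field; lra).
  assert (Hpos : 0 < m / S) by (apply Rdiv_lt_0_compat; lra).
  set (g := m / S) in *.
  assert (Hg1 : g <= m).
  { rewrite <- HmS. rewrite <- (Rmult_1_r g) at 1. apply Rmult_le_compat_l; lra. }
  split; [lra|]. intros gamma Hgamma.
  assert (B : forall X, 0 <= X <= S -> gamma * X <= m).
  { intros X HX. rewrite <- HmS. apply Rmult_le_compat; lra. }
  repeat split.
  - apply Rle_trans with m; [apply B; unfold S|]; lra.
  - apply Rle_trans with m; [apply B; unfold S|]; lra.
  - apply Rle_trans with m; [apply B; unfold S|]; lra.
  - apply Rle_trans with m; [apply B; unfold S|]; lra.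
  - apply Rle_trans with m; [apply B; unfold S|]; lra.
Qed.

Theorem theorem1 :
  forall (delta : R) (a0 b1 : R -> R) (Adelta : R -> Prop) (tau : R -> R)
         (beta : R -> R -> R) (chi : R -> R),
  0 < delta ->
  (exists a, Adelta a) ->
  compact Adelta ->
  (forall x, continuous tau x) ->
  (forall gamma, 0 < gamma ->
     globally_asymptotically_stable (avg_x_field b1 gamma) Adelta /\
     locally_exponentially_stable (avg_x_field b1 gamma) Adelta) ->
  (forall gamma, 0 < gamma ->
     globally_asymptotically_stable (avg_field a0 b1 gamma)
       (graph_on tau Adelta) /\
     locally_exponentially_stable (avg_field a0 b1 gamma)
       (graph_on tau Adelta)) ->
  class_KL beta ->
  class_Kinf (fun s => beta s 0) ->
  is_Kinf_inverse chi (fun s => beta s 0) ->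
  (forall gamma, 0 < gamma ->
     forall (T : Rbar) (xa : R -> R),
       is_solution (avg_x_field b1 gamma) T xa ->
       forall t : R, 0 <= t -> Rbar_lt t T ->
         dist_to Adelta (xa t) <= beta (dist_to Adelta (xa 0)) (gamma * t)) ->
  exists tbar gstar : R -> R -> R,
  forall (h : R -> R) (xstar : R) (m alpha : R -> R) (A : R),
  assumption1 h xstar ->
  assumption2 h xstar m alpha A ->
  (forall x, a0 x = fourier_a0 h delta x) ->
  (forall x, b1 x = fourier_b1 h delta x) ->
  (forall a, Adelta a -> xstar - delta <= a <= xstar + delta) ->
  forall r d bbar L r0 : R,
  0 < r -> 0 < d -> r - d - 2 * delta > 0 ->
  0 < bbar -> delta_star alpha delta >= A + bbar ->
  0 < L -> lipschitz_on (fun x => xstar - r <= x <= xstar + r) L h ->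
  r0 = chi (r - d - 2 * delta) ->
  0 <= tbar r0 d /\ 0 < gstar L d /\
  forall gamma, 0 < gamma < gstar L d ->
  forall x0 y0 : R,
  Rabs (x0 - xstar) <= r0 ->
  Rabs (y0 - a0 x0 / 2) <= gstar L d ->
  (exists z : R -> R * R,
     z 0 = (x0, y0) /\ is_solution (es_field h delta gamma) p_infty z) /\
  (forall (T : Rbar) (z : R -> R * R),
     z 0 = (x0, y0) -> is_solution (es_field h delta gamma) T z ->
     (exists B, forall t : R, 0 <= t -> Rbar_lt t T -> norm (z t) <= B) /\
     (forall t : R, 0 <= t -> Rbar_lt t T -> tbar r0 d / gamma <= t ->
        dist_to (graph_on tau Adelta) (z t) <= d)).
Proof.
  intros delta a0 b1 S tau beta chi Hdelta HS _ _ HSx HSg _ _ Hchi Hbeta.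
  (* A witness h1 reveals regularity and signs of a0 and b1 before the actual h is known; h may
     differ from h1. If there is no witness, no h satisfies the hypotheses and any constants do. *)
  destruct (classic (exists h1 xs1 m1 alpha1 A1 bbar1,
    assumption1 h1 xs1 /\ assumption2 h1 xs1 m1 alpha1 A1 /\
    (forall x, a0 x = fourier_a0 h1 delta x) /\ (forall x, b1 x = fourier_b1 h1 delta x) /\
    (forall a, S a -> xs1 - delta <= a <= xs1 + delta) /\
    0 < bbar1 /\ delta_star alpha1 delta >= A1 + bbar1)) as [HW|HW].
  2: { exists (fun _ _ => 0), (fun _ _ => 0). intros h xs m alpha A H1 H2 H3 H4 H5 r d bbar L r0
         _ _ _ Hb Hst. exfalso. apply HW. exists h, xs, m, alpha, A, bbar. tauto. }
  destruct HW as (h1 & xs1 & m1 & alpha1 & A1 & bbar1 & W1 & W2 & W3 & W4 & W5 & W6 & W7).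
  set (a := fun x => a0 x / 2). set (v := fun x => b1 x / 2).
  assert (Ehalf : forall u : R, u = 2 * u / 2) by (intros; field).
  assert (Havg : forall h, (forall x, a0 x = fourier_a0 h delta x) ->
    forall x, avg_a h delta x = a x).
  { intros h Hh x. unfold a. rewrite Hh. unfold fourier_a0, avg_a.
    apply Ehalf. }
  assert (Hvvg : forall h, (forall x, b1 x = fourier_b1 h delta x) ->
    forall x, avg_v h delta x = v x).
  { intros h Hh x. unfold v. rewrite Hh. unfold fourier_b1, avg_v.
    apply Ehalf. }
  assert (Ha1 := Havg h1 W3). assert (Hv1 := Hvvg h1 W4).
  destruct (completeness S) as [q Hq].
  { exists (xs1 + delta). intros s Hs. apply W5, Hs. }
  { exact HS. }
  destruct (completeness (fun s => S (- s))) as [p' Hp'].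
  { exists (- xs1 + delta). intros s Hs. generalize (W5 _ Hs). lra. }
  { destruct HS as [s Hs]. exists (- s). rewrite Ropp_involutive. exact Hs. }
  set (p := - p').
  assert (HSpq : forall s, S s -> p <= s <= q).
  { intros s Hs. split; [|apply Hq, Hs]. unfold p.
    assert (- s <= p'); [|lra]. apply Hp'. rewrite Ropp_involutive. exact Hs. }
  assert (Hpq : p <= q) by (destruct HS as [s Hs]; generalize (HSpq s Hs); lra).
  assert (HK : forall R, exists K, 0 < K /\
     lipschitz_on (fun z => p - R <= z <= q + R) K a /\
     lipschitz_on (fun z => p - R <= z <= q + R) K v /\
     forall z, p - R <= z <= q + R -> Rabs (a z) <= K /\ Rabs (v z) <= K).
  { intros R. destruct (averages_locally_bounded h1 delta (p - R) (q + R) (proj1 W1) Hdelta)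
      as (K & HK0 & HK1 & HK2 & HK3).
    exists K. split; [exact HK0|]. split; [|split].
    - intros y z Hy Hz. rewrite <- !Ha1. auto.
    - intros y z Hy Hz. rewrite <- !Hv1. auto.
    - intros z Hz. rewrite <- Ha1, <- Hv1. auto. }
  destruct (functional_choice _ HK) as [Kf HKf]. clear HK.
  assert (Hvc : forall x, continuous v x).
  { intros x. apply locally_lipschitz_continuous. intros z.
    (* The radius is such that the unit neighbourhood of z lies in [p - R, q + R]. *)
    set (R := 1 + Rabs (z - p) + Rabs (z - q)).
    destruct (HKf R) as (_ & _ & H & _). exists 1, (Kf R). split; [lra|].
    intros y w Hy Hw. apply Rabs_def2 in Hy, Hw.
    generalize (Rle_abs (z - q)), (Rle_abs (p - z)), (Rabs_pos (z - q)), (Rabs_pos (z - p)).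
    rewrite (Rabs_minus_sym p z). intros.
    apply H; unfold R; lra. }
  destruct (far_drift h1 m1 alpha1 xs1 A1 delta bbar1 W1 W2 Hdelta W6 W7)
    as (c0 & Hc0 & Hfar1 & Hfar2).
  (* Positivity of eta sits below the existential so that choice yields a total function; for other
     eta the default is 0. The window lengths below are obtained in the same way. *)
  assert (Hmargins : forall eta, exists c, 0 < eta -> 0 < c /\
    (forall x, q + eta <= x -> c <= v x) /\ (forall x, x <= p - eta -> v x <= - c)).
  { intros eta. destruct (Rlt_dec 0 eta) as [Heta|Heta]; [|exists 0; tauto].
    destruct (attractor_margins v S p q c0 (xs1 - delta) (xs1 + delta)) with (eta := eta)
      as (c & Hc); auto.
    - intros x Hx. apply (equilibrium_in_attractor b1 S x HS).
      + apply HSx. lra.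
      + unfold v in Hx. lra.
    - intros x Hx. rewrite <- Hv1. auto.
    - intros x Hx. rewrite <- Hv1. auto.
    - exists c. auto. }
  destruct (functional_choice _ Hmargins) as [cf Hcf]. clear Hmargins.
  set (K := Kf 1).
  destruct (HKf 1) as (HK0 & HKa & HKv & HKb). fold K in HK0, HKa, HKv, HKb.
  set (Y := output_bound K).
  assert (HY : 0 < Y) by (unfold Y, output_bound; nra).
  assert (Hwin : forall d, exists Tw, 0 < d -> 0 <= Tw /\ forall xa ya : R -> R,
    p - 1 <= xa 0 <= q + 1 -> Rabs (ya 0) <= Y ->
    (forall t, 0 <= t -> is_derive xa t (- v (xa t)) /\ is_derive ya t (a (xa t) - ya t)) ->
    forall s, Tw <= s -> dist_to (graph_on tau S) (xa s, ya s) <= d / 4).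
  { intros d. destruct (Rlt_dec 0 d) as [Hd|Hd]; [|exists 0; tauto].
    destruct (graph_window a0 b1 tau S p q Y (d / 4) HS HSpq) as (Tw & HTw); auto.
    - apply HSg. lra.
    - lra.
    - exists Tw. auto. }
  destruct (functional_choice _ Hwin) as [Twf HTwf]. clear Hwin.
  set (far := fun r0 => r0 + delta + 1).
  (* The summands are the descent over r0 + delta at rate c / 2, the decay of y - a(x), the window,
     and the rounding to whole periods. *)
  exists (fun r0 d => 2 * (r0 + delta) / cf (margin d) +
    (Kf (far r0) * Kf (far r0) + 1) + Twf d + 4).
  exists (fun L d => threshold K (Twf d) (cf (margin d)) delta L d).
  intros h xs m alpha A H1 _ H3 H4 H5 r d bbar L r0 Hr Hd Hrd _ _ HL Hlip Hr0.
  destruct (margin_spec d Hd) as [Hm1 Hm2].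
  destruct (Hcf (margin d) ltac:(lra)) as (Hc & Hvq & Hvp).
  destruct (HTwf d Hd) as [HTw Hwin].
  destruct (threshold_spec K (Twf d) (cf (margin d)) delta L d HK0 HTw Hc Hdelta HL Hd)
    as [Hth1 Hth2].
  set (gs := threshold K (Twf d) (cf (margin d)) delta L d) in *.
  set (eta := margin d) in *. set (c := cf eta) in *. set (Tw := Twf d) in *.
  destruct (Hchi (r - d - 2 * delta) ltac:(lra)) as (Hr0p & Hr0b & _).
  rewrite <- Hr0 in Hr0p, Hr0b.
  assert (Hr0le : r0 <= r - d - 2 * delta).
  { rewrite <- Hr0b.
    apply (beta_expands a0 b1 beta S q r0 HS Hq Hr0p (Hbeta 1 Rlt_0_1)).
    set (R := r0 + 1). destruct (HKf R) as (HR0 & HRa & HRv & HRb).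
    destruct (Hcf R ltac:(unfold R; lra)) as (HcR & HvR1 & HvR2).
    (* The radius r0 + 1 makes q + r0 an admissible start in an invariant interval; the y component
       starts at 0 and is discarded. *)
    destruct (average_solution a v (p - R) (q + R) (Kf R) (Kf R) (q + r0) 0)
      as (x & y & Hx0 & _ & Hxy); auto; try (unfold R; lra).
    - generalize (HvR1 (q + R) (Rle_refl _)). lra.
    - generalize (HvR2 (p - R) (Rle_refl _)). lra.
    - intros z Hz. apply HRb, Hz.
    - rewrite Rabs_R0. lra.
    - exists x. split; [exact Hx0|]. intros t Ht. apply (Hxy t Ht). }
  set (Kr := Kf (far r0)).
  destruct (HKf (far r0)) as (HKr0 & HKra & _ & HKrb). fold Kr in HKr0, HKra, HKrb.
  assert (Hc1 : 0 <= 2 * (r0 + delta) / c).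
  { apply Rmult_le_pos; [lra | apply Rlt_le, Rinv_0_lt_compat, Hc]. }
  split; [nra|]. split; [lra|].
  intros gamma Hgamma x0 y0 Hx0 Hy0.
  destruct (Hth2 gamma Hgamma) as (G1 & G2 & G3 & G4 & G5).
  assert (Hh : forall x, continuous h x) by (intros; apply smooth_continuous, H1).
  assert (Ha := Havg h H3). assert (Hv := Hvvg h H4).
  assert (Hpx : xs - delta <= p).
  { unfold p. assert (p' <= - xs + delta); [|lra]. apply Hp'. intros s Hs.
    generalize (H5 _ Hs). lra. }
  assert (Hqx : q <= xs + delta) by (apply Hq; intros s Hs; apply H5, Hs).
  assert (Hg01 : 0 < gamma <= 1) by lra.
  assert (Ea : forall x, a0 x / 2 = a x) by reflexivity.
  rewrite Ea in Hy0.
  assert (Hrr : 3 * eta + 2 * delta < r) by lra.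
  assert (Hrr0 : 3 * eta + r0 + delta < r) by lra.
  split.
  (* As long as x is within r - delta of xs, clamping changes nothing, and confinement keeps it
     there for all times; so this is a solution of the original system. *)
  - destruct (clamped_es_solution h xs r L delta gamma x0 y0 Hh Hr HL Hlip (proj1 Hgamma))
      as (x & y & X0 & Y0 & Hxy).
    set (g := fun x => h (clamp (xs - r) (xs + r) x)) in Hxy.
    assert (Hgh : forall t, Rabs (x t - xs) <= r - delta ->
      g (x t + delta * dither t) = h (x t + delta * dither t)).
    { intros t Ht. unfold g. rewrite clamp_id; [reflexivity|].
      apply (confined_inside delta xs r Hdelta _ Ht), dither_bound. }
    assert (Hconf : forall t, 0 <= t -> Rabs (x t - xs) < r - delta).
    { intros t Ht.
      apply (confinement h a v delta L xs r gamma p q eta c r0 p_infty x y); auto; try lra.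
      - intros s Hs _. destruct (Hxy s Hs) as [D1 D2].
        split; apply @ex_derive_continuous; eexists; eassumption.
      - intros s Hs _ Hin. rewrite <- Hgh by exact Hin. apply Hxy. lra.
      - rewrite X0. exact Hx0.
      - rewrite X0, Y0. lra.
      - exact I. }
    exists (fun t => (x t, y t)). split; [rewrite X0, Y0; reflexivity|].
    apply is_solution_pair. intros t Ht.
    unfold es_field; simpl fst; simpl snd.
    rewrite <- Hgh by (apply Rlt_le, Hconf, Ht). apply Hxy, Ht.
  - intros T z Hz0 Hz.
    destruct (is_solution_components _ T z Hz) as [Hcont Hder].
    set (x := fun t => fst (z (Rmax 0 t))) in *.
    set (y := fun t => snd (z (Rmax 0 t))) in *.
    assert (Hzxy : forall t, 0 <= t -> z t = (x t, y t)).
    { intros t Ht. unfold x, y. rewrite Rmax_right by exact Ht. apply surjective_pairing. }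
    assert (X0 : x 0 = x0) by (unfold x; rewrite Rmax_left, Hz0 by lra; reflexivity).
    assert (Y0 : y 0 = y0) by (unfold y; rewrite Rmax_left, Hz0 by lra; reflexivity).
    assert (Hder' : forall t, 0 < t -> Rbar_lt t T -> Rabs (x t - xs) <= r - delta ->
      is_derive x t (- gamma * (h (x t + delta * dither t) - y t) * dither t) /\
      is_derive y t (gamma * (h (x t + delta * dither t) - y t)))
      by (intros t Ht HtT _; exact (Hder t Ht HtT)).
    assert (Hx0' : Rabs (x 0 - xs) <= r0) by (rewrite X0; exact Hx0).
    assert (Hy0' : Rabs (y 0 - a (x 0)) <= 1) by (rewrite X0, Y0; lra).
    split.
    + destruct (trajectory_bounded h a v delta L xs r gamma p q eta c r0 T x y)
        as [B HB]; auto; try lra.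
      exists B. intros t Ht HtT. rewrite (Hzxy t Ht).
      eapply Rle_trans; [apply norm_pair_le | apply HB; assumption].
    + intros t Ht HtT Htt.
      assert (HG : exists z, graph_on tau S z).
      { destruct HS as [s Hs]. exists (s, tau s). split; [exact Hs | reflexivity]. }
      destruct (late_error_to_average h a v delta L xs r gamma p q eta c r0 T x y)
        with (K := K) (Kr := Kr) (Y := Y) (Tw := Tw) (w := d / 4) (t := t)
          (P := fun X Z => dist_to (graph_on tau S) (X, Z) <= d / 4)
        as (X & Z & HXZ & Herr); auto; try lra.
      * intros w Hw. apply HKrb, Hw.
      * destruct (Hcf 1 Rlt_0_1) as (C1 & C2 & _). generalize (C2 (q + 1) (Rle_refl _)). lra.
      * destruct (Hcf 1 Rlt_0_1) as (C1 & _ & C2). generalize (C2 (p - 1) (Rle_refl _)). lra.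
      * apply (Rmult_le_compat_l gamma) in Htt; [|lra].
        fold far Kr eta c Tw in Htt.
        set (tb := 2 * (r0 + delta) / c + (Kr * Kr + 1) + Tw + 4) in *.
        replace (gamma * (tb / gamma)) with tb in Htt by (field; lra). exact Htt.
      * rewrite (Hzxy t Ht).
        eapply Rle_trans; [apply (dist_to_triangle _ HG _ (X, Z))|].
        eapply Rle_trans;
          [apply Rplus_le_compat; [exact HXZ | apply (norm_pair_le (x t - X) (y t - Z))]|].
        (* The sum is d / 4 from the average solution, d / 4 from the averaging error, and 2 eta <=
           d / 4 from the unfinished period. *)
        lra.
Qed.
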